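(* For every $\varepsilon>0$ there is an integer $M=M(\varepsilon)\ge 1$, not depending on $n$, such that for every $\alpha\in(0,1)$ there exist maps $K_n$ ($n\ge 2$), where $K_n$ assigns to each graph on the vertex set $[n]$ a subset of $[n]$ of size at most $M$, with $$\liminf_{n\to\infty}\mathbb P\big(\pi_n(1)\in K_n(\pi_n(\mathcal F_n(\alpha)))\big)\ \ge\ 1-\varepsilon .$$ (That is, observing only the graph $\mathcal F_n(\alpha)$ without its vertex labels, one can construct a confidence set, of size not depending on $n$, that contains the root vertex $1$ with asymptotic probability at least $1-\varepsilon$.)
   Context: $[n]=\{1,\dots,n\}$; $\log$ is the natural logarithm; $d_G(v)$ is the degree of $v$ in the graph $G$. Uniform random recursive tree: $\mathcal T_1$ is the single vertex $1$; for $i\ge1$, given $\mathcal T_i$, the tree $\mathcal T_{i+1}$ is obtained by adding vertex $i+1$ and joining it by an edge to a vertex chosen uniformly at random from $\{1,\dots,i\}$. Thus $\mathcal T_n$ is a random tree on $[n]$ with root $1$. For $\alpha\in(0,1)$, the $\alpha$-forest $\mathcal F_n(\alpha)$ is the graph on vertex set $[n]$ obtained from $\mathcal T_n$ by removing every edge that has at least one endpoint $u$ with $d_{\mathcal T_n}(u)\le(1-\alpha)\log n$. Observation without labels: $\pi_n$ is a uniformly random permutation of $[n]$ independent of everything else, and for a graph $F$ on $[n]$, $\pi_n(F)$ is the graph on $[n]$ with edges $\{\pi_n(u),\pi_n(v)\}$, $\{u,v\}\in E(F)$. *)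

(* Defs.v *)
From HB Require Import structures.
From mathcomp Require Import all_boot all_order all_fingroup all_algebra.
From mathcomp Require Import reals ereal sequences exp.

Set Implicit Arguments.
Unset Strict Implicit.
Unset Printing Implicit Defensive.

Import Order.TTheory GRing.Theory Num.Theory.

Local Open Scope ring_scope.

(* Vertex sets are ['I_n]: the vertex labelled [i + 1] in [{1, ..., n}] is the
   ordinal of value [i], so the root [1] is [ord0]. *)

Definition edge_set n (E : {set {set 'I_n}}) : bool :=
  [forall e in E, #|e| == 2%N].

Record graph n := Graph { edges :> {set {set 'I_n}}; edgesP : edge_set edges }.

HB.instance Definition _ n := [isSub for @edges n].
HB.instance Definition _ n := [Equality of graph n by <:].
HB.instance Definition _ n := [Choice of graph n by <:].
HB.instance Definition _ n := [Countable of graph n by <:].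
HB.instance Definition _ n := [Finite of graph n by <:].

Definition deg n (G : graph n) (v : 'I_n) : nat := #|[set e in edges G | v \in e]|.

Lemma edge_set0 n : edge_set (set0 : {set {set 'I_n}}).
Proof. by apply/forall_inP => e; rewrite inE. Qed.

Definition empty_graph n : graph n := Graph (edge_set0 n).

(* [lift ord_max : 'I_n -> 'I_n.+1] preserves the value, so old vertices keep
   their labels and [ord_max] is the new vertex. *)
Definition attach_edges n (G : graph n) (j : 'I_n) : {set {set 'I_n.+1}} :=
  [set ord_max; lift ord_max j]
    |: [set [set lift ord_max u | u in e] | e : {set 'I_n} in edges G].

Lemma attach_edgesP n (G : graph n) (j : 'I_n) : edge_set (attach_edges G j).
Proof.
apply/forall_inP => e; rewrite !inE => /orP[/eqP->|/imsetP[e' e'G ->]].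
  by rewrite cards2 neq_lift.
by rewrite card_imset; [exact: (forall_inP (edgesP G)) | exact: lift_inj].
Qed.

Definition attach n (G : graph n) (j : 'I_n) : graph n.+1 :=
  Graph (attach_edgesP G j).

Definition relabel_edges n (s : 'S_n) (G : graph n) : {set {set 'I_n}} :=
  [set [set s u | u in e] | e : {set 'I_n} in edges G].

Lemma relabel_edgesP n (s : 'S_n) (G : graph n) : edge_set (relabel_edges s G).
Proof.
apply/forall_inP => _ /imsetP[e eG ->].
by rewrite card_imset; [exact: (forall_inP (edgesP G)) | exact: perm_inj].
Qed.

Definition relabel n (s : 'S_n) (G : graph n) : graph n :=
  Graph (relabel_edgesP s G).

Definition forest_edges (R : realType) (alpha : R) n (T : graph n) :
    {set {set 'I_n}} :=
  edges T :\: [set e : {set 'I_n} |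
    [exists u in e, (deg T u)%:R <= (1 - alpha) * ln (n%:R : R)]].

Lemma forest_edgesP (R : realType) (alpha : R) n (T : graph n) :
  edge_set (forest_edges alpha T).
Proof. by apply/forall_inP => e /setDP[eT _]; exact: (forall_inP (edgesP T)). Qed.

Definition forest (R : realType) (alpha : R) n (T : graph n) : graph n :=
  Graph (forest_edgesP alpha T).

(* [rrt_law R n] is the probability mass function of the uniform random
   recursive tree on [n.+1] vertices, given by the transition rule of the
   growth process. *)
Fixpoint rrt_law (R : realType) n : graph n.+1 -> R :=
  match n with
  | 0 => fun G => (G == empty_graph 1)%:R
  | m.+1 => fun G =>
      \sum_(T : graph m.+1) rrt_law R T *
        \sum_(j : 'I_m.+1) m.+1%:R^-1 * (G == attach T j)%:R
  end.

(* Joint mass function of the tree and an independent uniform permutation. *)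
Definition joint_law (R : realType) n (w : graph n.+1 * 'S_n.+1) : R :=
  rrt_law R w.1 * #|{: 'S_n.+1}|%:R^-1.

Definition prob (R : realType) n (E : pred (graph n.+1 * 'S_n.+1)) : R :=
  \sum_(w | E w) joint_law R w.

Lemma rrt_law_sum1 (R : realType) n : \sum_(G : graph n.+1) rrt_law R G = 1.
Proof.
have pt m (x : graph m) : \sum_(G : graph m) (G == x)%:R = 1 :> R.
  by rewrite (bigD1 x) //= eqxx big1 ?addr0 // => G /negbTE ->.
elim: n => [|n IHn]; rewrite ?pt //=.
rewrite exchange_big /= -[RHS]IHn; apply: eq_bigr => T _.
rewrite -big_distrr /= exchange_big /=.
under eq_bigr do rewrite -big_distrr /= pt mulr1.
by rewrite sumr_const card_ord -[_ *+ _]mulr_natr mulVf ?mulr1 ?pnatr_eq0.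
Qed.

Lemma prob_total (R : realType) n : prob R (n := n) predT = 1.
Proof.
rewrite /prob -(pair_bigA _ (fun T s => joint_law R (T, s))) /= /joint_law /=.
rewrite -[RHS](rrt_law_sum1 R n); apply: eq_bigr => T _.
rewrite sumr_const -[_ *+ _]mulr_natr mulfVK // pnatr_eq0 -lt0n.
by apply/card_gt0P; exists 1%g.
Qed.

(* Main.v *)
Require Import Defs.
From mathcomp Require Import all_boot all_order all_fingroup all_algebra.
From mathcomp Require Import reals ereal sequences exp.
From mathcomp Require Import ring lra zify.
From mathcomp Require Import topology normedtype.

Set Implicit Arguments.
Unset Strict Implicit.
Unset Printing Implicit Defensive.

Import Order.TTheory GRing.Theory Num.Theory.

Local Open Scope ring_scope.

(** Encode the recursive tree by the parent function [p], whose coordinates are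
    independent, [p i] being uniform on the vertices older than [i]. Call a vertex high
    if its degree exceeds [(1 - alpha) log n], so that the forest consists of the edges
    between high vertices.

    Estimator. A vertex [v] splits a triple if the three vertices lie in pairwise
    different components of the graph deprived of [v]. A triple is split by at most one
    vertex of a graph, so at most [M] vertices of the strictly largest component, of
    size [X], split at least [X^3 / M] triples; these vertices form the confidence set.

    The root belongs to it. Take [m = n^c] with [c] small. With high probability the
    first [m] vertices are all high, hence the forest contains the tree on [m] vertices.
    In that tree, at least three children of the root have subtrees of linear size, with
    probability close to 1 uniformly in [m]. Each retained cluster [x] hanging from this
    initial tree is attached to a uniform vertex of it, independently of everything else.
    By Chebyshev's inequality the mass of a branch is thus proportional to its size in
    the initial tree, as soon as [sum x^2] is negligible with respect to [(sum x)^2].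

    For the latter: most of the first [n^(alpha - eta)] vertices are retained, which
    bounds the total mass from below. Conversely, a cluster hanging from a vertex [t >= m]
    consists of descendants of [t] among the first [n^(alpha + eta)] vertices, of which
    there are at most about [n^(alpha + eta - c/4)] by a second moment bound, and of
    vertices within bounded distance of them, because no chain of [k] high vertices
    survives beyond [n^(alpha + eta)] if [k] is a large constant. The same bound makes
    the component of the root the strictly largest one. *)
(** * Root estimator *)

Lemma connect_homo (T T' : finType) (e : rel T) (e' : rel T') (f : T -> T') :
  (forall x y, e x y -> e' (f x) (f y)) ->
  forall x y, connect e x y -> connect e' (f x) (f y).
Proof.
move=> ef x y /connectP[p ep ->].
elim: p x ep => [|z p IHp] x /=; first by rewrite connect0.
by case/andP=> /ef/connect1 xz /IHp; exact: connect_trans.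
Qed.

Lemma connect_invariant (T : finType) (e : rel T) (P : pred T) :
  (forall x y, e x y -> P x -> P y) -> forall x y, connect e x y -> P x -> P y.
Proof.
move=> eP x y /connectP[p ep ->].
elim: p x ep => [|z p IHp] x //= /andP[exz ep] Px; exact: IHp (eP _ _ exz Px).
Qed.

Lemma card_bigcup_disjoint (I T : finType) (P : pred I) (F : I -> {set T}) :
  (forall i j, P i -> P j -> i != j -> [disjoint F i & F j]) ->
  (#|\bigcup_(i | P i) F i| = \sum_(i | P i) #|F i|)%N.
Proof.
move=> dF; pose F' i := if P i then F i else set0.
have dF' i j : i != j -> [disjoint F' i & F' j].
  by rewrite /F'; case: ifP => Pi; case: ifP => Pj ij;
    rewrite ?dF // -setI_eq0 ?setI0 ?set0I.
have eF : \bigcup_(i | P i) F i = \bigcup_i F' i by rewrite big_mkcond.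
rewrite eF -sum1_card (@partition_disjoint_bigcup _ _ _ _ _ F' (fun=> 1%N) dF').
rewrite [RHS]big_mkcond; apply: eq_bigr => i _.
by rewrite sum1_card /F'; case: ifP; rewrite ?cards0.
Qed.

Lemma leq_card_bigcup (I T : finType) (P : pred I) (F : I -> {set T}) :
  (#|\bigcup_(i | P i) F i| <= \sum_(i | P i) #|F i|)%N.
Proof.
elim/big_rec2: _ => [|i k A _ le]; first by rewrite cards0.
by apply: leq_trans (leq_card_setU _ _) _; rewrite leq_add2l.
Qed.

Section RootSet.
Local Open Scope nat_scope.
Context (n : nat).
Implicit Types (G : graph n) (v w x y : 'I_n) (s : 'S_n).

Definition adj G : rel 'I_n := fun x y => [set x; y] \in edges G.

Definition adj_off G v : rel 'I_n := fun x y => [&& adj G x y, x != v & y != v].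

Definition component G v : {set 'I_n} := [set w | connect (adj G) v w].

(** The vertex [v] is isolated in [adj_off G v], so it separates itself from every other vertex of
    its component, and a split triple may contain [v]. *)
Definition separates G v x y : bool :=
  [&& connect (adj G) v x, connect (adj G) v y & ~~ connect (adj_off G v) x y].

Definition triples G v : {set 'I_n * 'I_n * 'I_n} :=
  [set t | [&& separates G v t.1.1 t.1.2, separates G v t.1.1 t.2
             & separates G v t.1.2 t.2]].

(** Strictness in the first condition confines all members to a single component. The second is the
    threshold [X^3 / M] on ordered triples, with the division cleared. *)
Definition root_set M G : {set 'I_n} :=
  [set v | [forall w, connect (adj G) v w
                      || (#|component G w| < #|component G v|)]
           && (#|component G v| ^ 3 <= M * #|triples G v|)].

Lemma adjC G : symmetric (adj G).
Proof. by move=> x y; rewrite /adj setUC. Qed.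

Lemma adj_offC G v : symmetric (adj_off G v).
Proof. by move=> x y; rewrite /adj_off adjC (andbC (x != v)). Qed.

Lemma connect_adjC G : connect_sym (adj G).
Proof. by apply/sym_connect_sym/adjC. Qed.

Lemma connect_adj_offC G v : connect_sym (adj_off G v).
Proof. by apply/sym_connect_sym/adj_offC. Qed.

Lemma component_eq G v w : connect (adj G) v w -> component G v = component G w.
Proof.
move=> vw; apply/setP=> x; rewrite !inE.
by rewrite (same_connect (@connect_adjC G) vw).
Qed.

(* A path from [x] to [v] either passes through [v'], or its part before [v] witnesses
   the second alternative. *)
Lemma connect_avoid G v v' x : v != v' -> connect (adj G) v x ->
  ~~ connect (adj_off G v) x v' -> connect (adj_off G v') x v.
Proof.
move=> vv' vx xv'; move: vx; rewrite connect_adjC => /connectP[p].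
elim: p x xv' => [|z p IHp] x xv' /=; first by move=> _ ->; exact: connect0.
have [->|xv] := eqVneq x v; first by rewrite connect0.
have xNv' : x != v' by apply: contraNneq xv' => ->; exact: connect0.
case/andP=> exz ep lastp.
have [zv|zv] := eqVneq z v.
  by apply: connect1; rewrite /adj_off -zv exz xNv' zv.
have xz : adj_off G v x z by rewrite /adj_off exz xv.
have zv' : ~~ connect (adj_off G v) z v'.
  by apply: contra xv'; exact: connect_trans (connect1 xz).
have zNv' : z != v' by apply: contraNneq zv' => ->; exact: connect0.
apply: connect_trans (IHp z zv' ep lastp).
by apply: connect1; rewrite /adj_off exz xNv'.
Qed.

(* The median of three vertices is unique in every graph. *)
Lemma triples_disjoint G v v' : v != v' -> [disjoint triples G v & triples G v'].
Proof.
move=> vv'; rewrite -setI_eq0; apply/eqP/setP => -[[x y] z].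
rewrite !inE /=; apply/negP => /andP[/and3P[sxy sxz syz] /and3P[sxy' sxz' syz']].
have sep a b : separates G v a b -> separates G v' a b ->
    connect (adj_off G v) a v' || connect (adj_off G v) b v'.
  case/and3P=> va vb ab /and3P[va' vb' ab'].
  apply/norP=> -[a1 b1]; case/negP: ab'.
  apply: connect_trans (connect_avoid vv' va a1) _.
  by rewrite connect_adj_offC; exact: connect_avoid vv' vb b1.
have excl a b : separates G v a b -> connect (adj_off G v) a v' ->
    connect (adj_off G v) b v' -> False.
  case/and3P=> _ _ /negP ab av bv; apply: ab; apply: connect_trans av _.
  by rewrite connect_adj_offC.
case/orP: (sep _ _ sxy sxy') => [xv|yv].
  case/orP: (sep _ _ syz syz'); [exact: excl sxy xv | exact: excl sxz xv].
case/orP: (sep _ _ sxz sxz') => [xv|zv]; [exact: excl sxy xv yv|].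
exact: excl syz yv zv.
Qed.

(** All members share one component [C], by strict maximality. Their sets of triples are disjoint
    subsets of the cube of [C], each with at least [#|C| ^ 3 / M] elements. *)
Lemma card_root_set M G : #|root_set M G| <= M.
Proof.
have [->|[v0 v0K]] := set_0Vmem (root_set M G); first by rewrite cards0.
pose C := component G v0.
have KC v : v \in root_set M G -> component G v = C.
  move=> vK; apply: component_eq; move: vK v0K.
  rewrite !inE => /andP[/forallP/(_ v0)/orP[//|lt1] _].
  case/andP=> /forallP/(_ v)/orP[|lt2 _]; first by rewrite connect_adjC.
  by move: (ltn_trans lt1 lt2); rewrite ltnn.
have C0 : 0 < #|C| ^ 3.
  rewrite expn_gt0; apply/orP; left; apply/card_gt0P; exists v0.
  by rewrite inE connect0.
rewrite -(leq_pmul2r C0).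
have -> : #|root_set M G| * #|C| ^ 3 = \sum_(v in root_set M G) #|C| ^ 3.
  by rewrite sum_nat_const.
have le1 : \sum_(v in root_set M G) #|C| ^ 3 <=
           \sum_(v in root_set M G) M * #|triples G v|.
  apply: leq_sum => v vK; rewrite -(KC v vK).
  by move: vK; rewrite inE => /andP[].
apply: leq_trans le1 _; rewrite -big_distrr /= leq_mul2l; apply/orP; right.
have -> : #|C| ^ 3 = #|setX (setX C C) C| by rewrite !cardsX !expnS expn0 muln1 mulnA.
rewrite -card_bigcup_disjoint; last by move=> i j _ _; exact: triples_disjoint.
apply: subset_leq_card; apply/bigcupsP => v vK; apply/subsetP => -[[x y] z].
rewrite -(KC v vK) !inE /= => /and3P[/and3P[-> -> _] /and3P[_ -> _] _] //.
Qed.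

(** * Equivariance of the estimator under relabelling *)

Lemma adj_relabel s G x y : adj (relabel s G) (s x) (s y) = adj G x y.
Proof.
rewrite /adj /relabel /= /relabel_edges.
have -> : [set s x; s y] = [set s u | u in [set x; y]] by rewrite imsetU1 imset_set1.
by rewrite mem_imset //; exact: imset_inj perm_inj.
Qed.

Lemma adj_off_relabel s G v x y :
  adj_off (relabel s G) (s v) (s x) (s y) = adj_off G v x y.
Proof. by rewrite /adj_off adj_relabel !(inj_eq perm_inj). Qed.

Lemma connect_relabel s (e e' : rel 'I_n) :
  (forall x y, e' (s x) (s y) = e x y) ->
  forall x y, connect e' (s x) (s y) = connect e x y.
Proof.
move=> ee x y; apply/idP/idP; last by apply: connect_homo => a b; rewrite ee.
move=> h; rewrite -(permK s x) -(permK s y); move: h; apply: connect_homo => a b.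
by rewrite -{1}(permKV s a) -{1}(permKV s b) ee.
Qed.

Lemma card_relabel s G v : #|component (relabel s G) (s v)| = #|component G v|.
Proof.
rewrite -(card_imset (component G v) (@perm_inj _ s)).
apply: eq_card => w; rewrite -(permKV s w) (mem_imset _ _ (@perm_inj _ s)) !inE.
by rewrite (connect_relabel (adj_relabel s G)).
Qed.

Lemma separates_relabel s G v x y :
  separates (relabel s G) (s v) (s x) (s y) = separates G v x y.
Proof.
rewrite /separates !(connect_relabel (adj_relabel s G)).
by rewrite (connect_relabel (@adj_off_relabel s G v)).
Qed.

Lemma card_triples_relabel s G v : #|triples (relabel s G) (s v)| = #|triples G v|.
Proof.
pose f (t : 'I_n * 'I_n * 'I_n) := (s t.1.1, s t.1.2, s t.2).
have f_inj : injective f.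
  by move=> [[a b] c] [[a' b'] c'] [/perm_inj-> /perm_inj-> /perm_inj->].
rewrite -(card_imset (triples G v) f_inj).
apply: eq_card => -[[a b] c].
rewrite -(permKV s a) -(permKV s b) -(permKV s c).
rewrite -[(s _, s _, s _)]/(f (_, _, _)) mem_imset //.
by rewrite !inE /= !separates_relabel.
Qed.

Lemma root_set_relabel M s G v :
  (s v \in root_set M (relabel s G)) = (v \in root_set M G).
Proof.
rewrite !inE card_relabel card_triples_relabel; congr (_ && _).
apply/forallP/forallP => h w.
  by have := h (s w); rewrite card_relabel (connect_relabel (adj_relabel s G)).
by rewrite -(permKV s w) card_relabel (connect_relabel (adj_relabel s G)).
Qed.

End RootSet.

(** * Parent functions and the product measure *)

Definition parents n := {ffun 'I_n.+1 -> 'I_n.+1}.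

(** The bound [maxn 1 i] makes the root its own parent: [p] is a total function whose iterates stop
    at the root. *)
Definition admissible n (p : parents n) : bool := [forall i, (p i < maxn 1 i)%N].

(** The restriction to [p i < i] discards the loop at the root. *)
Definition tree_edges n (p : parents n) : {set {set 'I_n.+1}} :=
  [set [set i; p i] | i in [set i | (p i < i)%N]].

Lemma tree_edgesP n (p : parents n) : edge_set (tree_edges p).
Proof.
apply/forall_inP => _ /imsetP[i + ->]; rewrite inE => pi; rewrite cards2.
by rewrite (_ : i != p i) // neq_ltn pi orbT.
Qed.

Definition tree n (p : parents n) : graph n.+1 := Graph (tree_edgesP p).

Definition extend n (p : parents n) (j : 'I_n.+1) : parents n.+1 :=
  [ffun i => lift ord_max (if unlift ord_max i is Some i' then p i' else j)].

Lemma attach_tree n (p : parents n) j : attach (tree p) j = tree (extend p j).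
Proof.
apply: val_inj; rewrite /= /attach_edges /=.
have ext_max : extend p j ord_max = lift ord_max j by rewrite ffunE unlift_none.
have ext_lift i : extend p j (lift ord_max i) = lift ord_max (p i).
  by rewrite ffunE liftK.
apply/setP => e; rewrite !inE; apply/orP/imsetP => [[/eqP->|]|].
- exists ord_max; last by rewrite ext_max.
  by rewrite inE ext_max lift_max /=.
- case/imsetP => _ /imsetP[i + ->] ->; rewrite inE => pi.
  exists (lift ord_max i); first by rewrite inE ext_lift !lift_max.
  by rewrite ext_lift imsetU1 imset_set1.
- case=> i; case: (unliftP ord_max i) => [i'|] ->; last first.
    by rewrite ext_max => _ ->; left.
  rewrite inE ext_lift !lift_max => pi ->; right; apply/imsetP.
  exists [set i'; p i']; last by rewrite imsetU1 imset_set1.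
  by apply/imsetP; exists i' => //; rewrite inE.
Qed.

Section Space.
Context (R : realType).

Definition attach_prob n (i j : 'I_n.+1) : R :=
  (j < maxn 1 i)%:R / (maxn 1 i)%:R.

Definition weight n (p : parents n) : R := \prod_i attach_prob i (p i).

Definition Ex n (f : parents n -> R) : R := \sum_p weight p * f p.

Definition Pr n (E : pred (parents n)) : R := Ex (fun p => (E p)%:R).

Lemma attach_prob_ge0 n (i j : 'I_n.+1) : 0 <= attach_prob i j.
Proof. by rewrite divr_ge0 ?ler0n. Qed.

Lemma attach_prob0 n (i j : 'I_n.+1) : (maxn 1 i <= j)%N -> attach_prob i j = 0.
Proof. by rewrite leqNgt /attach_prob => /negbTE->; rewrite mul0r. Qed.

Lemma attach_prob_le n (i j : 'I_n.+1) : attach_prob i j <= (maxn 1 i)%:R^-1.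
Proof.
rewrite /attach_prob; case: (_ < _)%N; rewrite ?mul1r ?mul0r //.
Qed.

Lemma sum_attach_prob n (i : 'I_n.+1) (f : 'I_n.+1 -> R) :
  \sum_j attach_prob i j * f j =
  (maxn 1 i)%:R^-1 * \sum_(j : 'I_n.+1 | (j < maxn 1 i)%N) f j.
Proof.
rewrite big_distrr /= [RHS]big_mkcond; apply: eq_bigr => j _ /=.
by rewrite /attach_prob; case: (_ < _)%N; rewrite ?mul1r ?mul0r // mulrC.
Qed.

Lemma attach_prob_sum1 n (i : 'I_n.+1) : \sum_j attach_prob i j = 1.
Proof.
under eq_bigr do rewrite -[attach_prob _ _]mulr1.
rewrite sum_attach_prob sumr_const.
have -> : #|[pred j : 'I_n.+1 | (j < maxn 1 i)%N]| = maxn 1 i.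
  rewrite -sum1_card -(big_ord_widen n.+1 (fun=> 1%N)).
    by rewrite sum1_card card_ord.
  by rewrite geq_max (ltnW (ltn_ord i)).
by rewrite mulVf // pnatr_eq0; lia.
Qed.

Lemma weight_ge0 n (p : parents n) : 0 <= weight p.
Proof. by apply: prodr_ge0 => i _; exact: attach_prob_ge0. Qed.

Lemma weight_neq0 n (p : parents n) : weight p != 0 -> admissible p.
Proof.
move=> w0; apply/forallP => i; apply: contraR w0; rewrite -leqNgt => /attach_prob0 pi.
by apply/eqP; rewrite /weight (bigD1 i) //= pi mul0r.
Qed.

Lemma eq_Ex n (f g : parents n -> R) :
  (forall p, admissible p -> f p = g p) -> Ex f = Ex g.
Proof.
move=> fg; apply: eq_bigr => p _.
by have [->|/weight_neq0/fg->//] := eqVneq (weight p) 0; rewrite !mul0r.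
Qed.

Lemma le_Ex n (f g : parents n -> R) :
  (forall p, admissible p -> f p <= g p) -> Ex f <= Ex g.
Proof.
move=> fg; apply: ler_sum => p _.
have [->|/weight_neq0/fg fgp] := eqVneq (weight p) 0; first by rewrite !mul0r.
by rewrite ler_wpM2l // weight_ge0.
Qed.

Lemma ExD n (f g : parents n -> R) : Ex (fun p => f p + g p) = Ex f + Ex g.
Proof. by rewrite /Ex -big_split; apply: eq_bigr => p _; rewrite mulrDr. Qed.

Lemma ExZ n a (f : parents n -> R) : Ex (fun p => a * f p) = a * Ex f.
Proof. by rewrite /Ex big_distrr; apply: eq_bigr => p _; rewrite mulrCA. Qed.

Lemma Ex_sum n (I : Type) (r : seq I) (P : pred I) (f : I -> parents n -> R) :
  Ex (fun p => \sum_(i <- r | P i) f i p) = \sum_(i <- r | P i) Ex (f i).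
Proof. by rewrite exchange_big; apply: eq_bigr => p _; rewrite big_distrr. Qed.

Lemma Ex_prod n (g : 'I_n.+1 -> 'I_n.+1 -> R) :
  Ex (fun p => \prod_i g i (p i)) = \prod_i \sum_j attach_prob i j * g i j.
Proof. by rewrite bigA_distr_bigA; apply: eq_bigr => p _; rewrite -big_split. Qed.

Lemma Ex_cst n (a : R) : Ex (fun _ : parents n => a) = a.
Proof.
have -> : Ex (fun _ : parents n => a) = a * Ex (fun p : parents n => \prod_(i < n.+1) 1).
  by rewrite -ExZ; apply: eq_Ex => p _; rewrite big1 ?mulr1.
rewrite (Ex_prod (fun _ _ => 1)) big1 ?mulr1 // => i _.
by under eq_bigr do rewrite mulr1; exact: attach_prob_sum1.
Qed.

Lemma markov n (E : pred (parents n)) (f : parents n -> R) a : 0 < a ->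
  (forall p, admissible p -> 0 <= f p) ->
  (forall p, admissible p -> E p -> a <= f p) -> Pr E <= Ex f / a.
Proof.
move=> a0 f0 fE; rewrite ler_pdivlMr // mulrC -ExZ; apply: le_Ex => p vp.
by case Ep: (E p); rewrite ?mulr1 ?mulr0; [exact: fE | exact: f0].
Qed.

Lemma Pr_sub n (E F : pred (parents n)) :
  (forall p, admissible p -> E p -> F p) -> Pr E <= Pr F.
Proof.
move=> EF; apply: le_Ex => p vp; rewrite ler_nat.
by case Ep: (E p) => //; rewrite (EF p).
Qed.

Lemma PrU_le n (E F : pred (parents n)) a b : Pr E <= a -> Pr F <= b ->
  Pr (fun p => E p || F p) <= a + b.
Proof.
move=> Ea Fb; apply: le_trans (lerD Ea Fb); rewrite -ExD; apply: le_Ex => p _.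
by rewrite -natrD ler_nat; case: (E p); case: (F p).
Qed.

Lemma PrC n (E : pred (parents n)) : Pr (fun p => ~~ E p) = 1 - Pr E.
Proof.
apply/eqP; rewrite eq_sym subr_eq -ExD -[X in X == _](Ex_cst n); apply/eqP.
by apply: eq_Ex => p _; rewrite -natrD; case: (E p).
Qed.

Lemma Pr_exists n (I : finType) (P : pred I) (E : I -> pred (parents n)) :
  Pr (fun p => [exists i, P i && E i p]) <= \sum_(i | P i) Pr (E i).
Proof.
rewrite -Ex_sum; apply: le_Ex => p _.
case: existsP => [[i /andP[Pi Ei]]|_]; last by rewrite sumr_ge0.
by rewrite (bigD1 i) //= Ei lerDl sumr_ge0.
Qed.

Definition update n (p : parents n) (s j : 'I_n.+1) : parents n :=
  [ffun i => if i == s then j else p i].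

(** Resampling one coordinate preserves the law, because exchanging [j] with [p s] is an involution
    that preserves the product of the weights. This replaces conditioning on all the other
    coordinates. *)
Lemma Ex_update n (s : 'I_n.+1) (f : parents n -> R) :
  Ex f = Ex (fun p => \sum_j attach_prob s j * f (update p s j)).
Proof.
transitivity (\sum_p \sum_j weight p * attach_prob s j * f p).
  apply: eq_bigr => p _; rewrite -big_distrl -big_distrr /=.
  by rewrite attach_prob_sum1 mulr1.
transitivity (\sum_p \sum_j weight p * attach_prob s j * f (update p s j)); last first.
  apply: eq_bigr => p _; rewrite big_distrr /=.
  by apply: eq_bigr => j _; rewrite mulrA.
rewrite !pair_bigA /=.
pose h (q : parents n * 'I_n.+1) := (update q.1 s q.2, q.1 s).
have hK : involutive h.
  case=> p j; rewrite /h /= ffunE eqxx; congr pair.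
  by apply/ffunP => i; rewrite !ffunE; case: eqP => [->|].
rewrite (reindex_inj (inv_inj hK)) /=; apply: eq_bigr => -[p j] _ /=.
congr (_ * _); rewrite /weight (bigD1 s) //= [in RHS](bigD1 s) //= ffunE eqxx.
rewrite [LHS]mulrC -[RHS]mulrA; congr (_ * _); rewrite [RHS]mulrC; congr (_ * _).
by apply: eq_bigr => i /negbTE is_; rewrite ffunE is_.
Qed.

(** Take two independent copies and exchange their coordinates outside [B]: the joint weight is
    preserved, while [f p * g p] becomes [f p * g q]. *)
Lemma Ex_indep n (B : pred 'I_n.+1) (f g : parents n -> R) :
  (forall p q : parents n, admissible p -> admissible q ->
     {in B, p =1 q} -> f p = f q) ->
  (forall p q : parents n, admissible p -> admissible q ->
     {in [predC B], p =1 q} -> g p = g q) ->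
  Ex (fun p => f p * g p) = Ex f * Ex g.
Proof.
move=> fB gB.
pose mix (p q : parents n) : parents n := [ffun i => if B i then p i else q i].
pose h (r : parents n * parents n) := (mix r.1 r.2, mix r.2 r.1).
have hK : involutive h.
  case=> p q; rewrite /h /=; congr pair; apply/ffunP => i; rewrite !ffunE;
    by case: (B i).
rewrite {2 3}/Ex big_distrlr /= pair_bigA /=.
transitivity (\sum_(r : parents n * parents n) weight r.1 * weight r.2 * (f r.1 * g r.1)).
  rewrite -(pair_bigA _ (fun p q => weight p * weight q * (f p * g p))) /=.
  apply: eq_bigr => p _.
  under eq_bigr do rewrite mulrAC mulrC.
  rewrite -big_distrl /=; rewrite -[LHS]mul1r; congr (_ * _).
  by rewrite -[LHS](Ex_cst n); apply: eq_bigr => q _; rewrite mulr1.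
rewrite (reindex_inj (inv_inj hK)) /=; apply: eq_bigr => -[p q] _ /=.
have ww : weight (mix p q) * weight (mix q p) = weight p * weight q.
  rewrite /weight -!big_split /=; apply: eq_bigr => i _; rewrite !ffunE.
  by case: ifP => // _; rewrite mulrC.
rewrite [RHS]mulrACA ww; have [->|] := eqVneq (weight p * weight q) 0; first by rewrite !mul0r.
rewrite mulf_eq0 => /norP[/weight_neq0 vp /weight_neq0 vq]; congr (_ * (_ * _)).
- apply: fB => //; last by move=> i Bi; rewrite ffunE (Bi : B i).
  by apply/forallP => i; rewrite ffunE; case: ifP => _; [move/forallP: vp|move/forallP: vq].
- apply: gB => //; last by move=> i; rewrite inE => /negbTE Bi; rewrite ffunE (Bi : B i = false).
  by apply/forallP => i; rewrite ffunE; case: ifP => _; [move/forallP: vp|move/forallP: vq].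
Qed.

(** A parent function taking the value [ord_max] has weight zero; the others decompose uniquely into
    their restriction and the parent of the last vertex. *)
Lemma Ex_extend n (f : parents n.+1 -> R) :
  Ex f = Ex (fun p => \sum_j n.+1%:R^-1 * f (extend p j)).
Proof.
pose P (p : parents n.+1) := [forall i, p i != ord_max].
have -> : Ex f = \sum_(p | P p) weight p * f p.
  rewrite [RHS]big_mkcond; apply: eq_bigr => p _; case: ifP => // /forallPn[i].
  rewrite negbK => /eqP pi; rewrite /weight (bigD1 i) //= attach_prob0 ?mul0r ?pi //=.
  by rewrite geq_max /= -ltnS.
pose h (q : parents n * 'I_n.+1) := extend q.1 q.2.
(* The default [ord0] is reached only at [ord_max], a value excluded by [P]. *)
pose dfl (j : 'I_n.+2) : 'I_n.+1 := odflt ord0 (unlift ord_max j).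
pose h' (p : parents n.+1) : parents n * 'I_n.+1 :=
  ([ffun i => dfl (p (lift ord_max i))], dfl (p ord_max)).
have dflK j : j != ord_max -> lift ord_max (dfl j) = j.
  by rewrite /dfl; case: unliftP => [i ->|-> /eqP].
rewrite (reindex_onto h h') /=; last first.
  move=> p /forallP Pp; apply/ffunP => i; rewrite ffunE /=.
  by case: unliftP => [i' ->|->]; rewrite ?ffunE dflK.
rewrite (eq_bigl predT); last first.
  move=> [p j]; apply/andP; split; first by apply/forallP => i; rewrite ffunE eq_sym neq_lift.
  rewrite /h' /h /dfl /=; apply/eqP; congr pair.
    by apply/ffunP => i; rewrite !ffunE !liftK.
  by rewrite ffunE unlift_none liftK.
rewrite -(pair_bigA _ (fun p j => weight (h (p, j)) * f (h (p, j)))) /=.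
apply: eq_bigr => p _; rewrite big_distrr /=; apply: eq_bigr => j _.
rewrite mulrA /h /=; congr (_ * _); rewrite /weight big_ord_recr /=; congr (_ * _).
  apply: eq_bigr => i _.
  have -> : widen_ord (leqnSn n.+1) i = lift ord_max i.
    by apply: val_inj; rewrite /= /bump leqNgt ltn_ord.
  by rewrite ffunE liftK /attach_prob !lift_max.
rewrite ffunE unlift_none /attach_prob lift_max [maxn _ _](maxn_idPr _) //.
by rewrite ltn_ord mul1r.
Qed.

(** One step of the growth process appends one uniform coordinate, so induction transfers every
    expectation to the product measure. *)
Lemma rrt_law_tree n (f : graph n.+1 -> R) :
  \sum_G rrt_law R G * f G = Ex (fun p => f (tree p)).
Proof.
elim: n f => [|n IHn] f /=.
  rewrite (bigD1 (empty_graph 1)) //= eqxx mul1r big1 ?addr0; last first.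
    by move=> G /negbTE->; rewrite mul0r.
  rewrite -[LHS](Ex_cst 0); apply: eq_Ex => p _; congr f; apply: val_inj => /=.
  apply/setP => e; rewrite inE; apply/esym/imsetP => -[i].
  by rewrite inE [i]ord1 ltn0.
rewrite Ex_extend.
transitivity (\sum_T rrt_law R T * \sum_(j < n.+1) n.+1%:R^-1 * f (attach T j)).
  under eq_bigr do rewrite big_distrl /=.
  rewrite exchange_big; apply: eq_bigr => T _ /=.
  under eq_bigr do rewrite -mulrA.
  rewrite -big_distrr /=; congr (_ * _).
  under eq_bigr do rewrite big_distrl /=.
  rewrite exchange_big; apply: eq_bigr => j _ /=.
  rewrite (bigD1 (attach T j)) //= eqxx mulr1 big1 ?addr0 // => G /negbTE->.
  by rewrite mulr0 mul0r.
rewrite (IHn (fun T => \sum_(j < n.+1) n.+1%:R^-1 * f (attach T j))).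
by apply: eq_Ex => p _; apply: eq_bigr => j _; rewrite attach_tree.
Qed.

Lemma prob_tree n (S : pred (graph n.+1)) (E : pred (graph n.+1 * 'S_n.+1)) :
  (forall w, E w = S w.1) -> prob R E = Pr (fun p => S (tree p)).
Proof.
move=> ES; rewrite /prob /Pr -(rrt_law_tree (fun G => (S G)%:R)) big_mkcond /=.
under eq_bigr do rewrite ES.
rewrite -(pair_bigA _ (fun G s => if S G then joint_law R (G, s) else 0)) /=.
apply: eq_bigr => G _.
case: (S G); rewrite ?mulr1 ?mulr0; last by rewrite big1.
rewrite /joint_law /= sumr_const -[_ *+ _]mulr_natr mulfVK // pnatr_eq0 -lt0n.
by apply/card_gt0P; exists 1%g.
Qed.

End Space.

(** * Clusters of high vertices *)

Section FunctionalGraph.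
Context (T : finType) (f : T -> T).

Lemma iter_fixed k x : f x = x -> iter k f x = x.
Proof. by move=> fx; elim: k => //= k ->. Qed.

Lemma fconnect_fixed x y : f x = x -> fconnect f x y -> y = x.
Proof. by move=> fx /iter_findex <-; exact: iter_fixed. Qed.

Lemma fconnect_next x y : fconnect f x y -> x != y -> fconnect f (f x) y.
Proof.
move=> /iter_findex; case: (findex f x y) => [/= ->|k]; first by rewrite eqxx.
by rewrite iterSr => <-; rewrite fconnect_iter.
Qed.

Lemma fconnect_linear x y z :
  fconnect f x y -> fconnect f x z -> fconnect f y z || fconnect f z y.
Proof.
move=> /iter_findex <- /iter_findex <-; move: (findex f x y) (findex f x z) => k l.
have [kl|/ltnW lk] := leqP k l.
  by rewrite -(subnK kl) iterD fconnect_iter.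
by rewrite -(subnK lk) iterD fconnect_iter orbT.
Qed.

Lemma fconnect_fixed_eq x y z : f y = y -> f z = z ->
  fconnect f x y -> fconnect f x z -> y = z.
Proof.
by move=> fy fz xy xz; case/orP: (fconnect_linear xy xz) => /fconnect_fixed ->.
Qed.

(** The orbit would stay at a fixed iterate, which would then be [y] itself, reached earlier than
    [findex] allows. *)
Lemma iter_findex_neq x y i :
  fconnect f x y -> (i < findex f x y)%N -> f (iter i f x) != iter i f x.
Proof.
move=> xy ik; apply/negP => /eqP fix_i.
have io : (i < fingraph.order f x)%N by apply: ltn_trans ik (findex_max xy).
have : y = iter i f x.
  by rewrite -{1}(iter_findex xy) -(subnK (ltnW ik)) iterD iter_fixed.
by move=> yi; move: ik; rewrite yi findex_iter // ltnn.
Qed.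

End FunctionalGraph.

Section Clusters.
Local Open Scope nat_scope.
Context (n : nat).
Implicit Types (p q : parents n) (hi : pred 'I_n.+1) (m : nat) (x y t v : 'I_n.+1).

Lemma admissible_lt p x : admissible p -> 0 < x -> p x < x.
Proof. by move=> /forallP/(_ x) + x0; rewrite (maxn_idPr x0). Qed.

Lemma admissible_le p x : admissible p -> p x <= x.
Proof. by move=> /forallP/(_ x); rewrite leq_max => /orP[|/ltnW//]; case: (nat_of_ord (p x)). Qed.

Lemma admissible0 p : admissible p -> p ord0 = ord0.
Proof. by move=> /admissible_le h; apply: val_inj; have := h ord0; rewrite leqn0 => /eqP. Qed.

Lemma iter_le p k x : admissible p -> iter k p x <= x.
Proof. by move=> vp; elim: k => //= k; apply: leq_trans (admissible_le _ vp). Qed.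

Definition indeg p v : nat := #|[set i | (p i < i) && (p i == v)]|.

Lemma deg_tree p v : admissible p -> deg (tree p) v = indeg p v + (0 < v).
Proof.
move=> vp; pose A := [set i : 'I_n.+1 | (p i < i) && ((i == v) || (p i == v))].
have -> : deg (tree p) v = #|A|.
  pose f i := [set i; p i].
  (* An edge determines its child, the larger of its two ends. *)
  have f_inj : {in [set i : 'I_n.+1 | p i < i] &, injective f}.
    move=> i j; rewrite !inE => pi pj /setP e.
    have := e j; rewrite !inE eqxx /= => /orP[/eqP//|/eqP jpi].
    have := e i; rewrite !inE eqxx /= => /esym/orP[/eqP//|/eqP ipj].
    by move: pi pj; rewrite -jpi -ipj => /ltnW; rewrite leqNgt => /negbTE ->.
  rewrite /deg -(card_in_imset (f := f) (D := A)); last first.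
    by move=> i j; rewrite !inE => /andP[pi _] /andP[pj _]; apply: f_inj; rewrite inE.
  apply: eq_card => e; rewrite inE; apply/andP/imsetP => [[/imsetP[i]]|[i]].
    rewrite inE => pi -> ; rewrite !inE => vi; exists i => //.
    by rewrite inE pi !(eq_sym _ v).
  rewrite inE => /andP[pi vi] ->; split; first by apply/imsetP; exists i; rewrite ?inE.
  by rewrite !inE !(eq_sym v).
have -> : A = [set i | (p i < i) && (p i == v)] :|: (if 0 < v then [set v] else set0).
  apply/setP => i; rewrite !inE.
  case: ifP => v0; rewrite !inE; last first.
    rewrite orbF; case pi: (p i < i) => //=; case: eqVneq => // iv.
    by move: pi; rewrite iv; lia.
  have [->|] := eqVneq i v; last by rewrite /= orbF.
  by rewrite admissible_lt //= orbT.
rewrite cardsU; case: ifP => v0; last by rewrite cards0 setI0 cards0 subn0.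
rewrite cards1 (_ : _ :&: _ = set0) ?cards0 ?subn0 //.
apply/setP => i; rewrite !inE; case: (eqVneq i v) => [->|]; last by rewrite andbF.
by rewrite andbT; case: ltngtP => // /ltn_eqF; rewrite -val_eqE => ->.
Qed.

(* The forest edges with both endpoints at least [m], directed towards the root: the
   fixed points of [step] are the oldest vertices of the components. *)
Definition step hi m p x := if [&& m <= p x, hi x & hi (p x)] then p x else x.

Definition branch hi m p t : {set 'I_n.+1} := [set x | fconnect (step hi m p) x t].

Lemma step_neq hi m p x : step hi m p x != x ->
  [/\ step hi m p x = p x, m <= p x, hi x & hi (p x)].
Proof. by rewrite /step; case: ifP => [/and3P[]|_]; rewrite ?eqxx. Qed.

Lemma step_root hi m p : admissible p -> step hi m p ord0 = ord0.
Proof. by move=> vp; rewrite /step (admissible0 vp); case: ifP. Qed.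

Lemma step_fconnect hi p x y : fconnect (step hi 0 p) x y -> fconnect p x y.
Proof.
move=> /iter_findex <-; elim: (findex _ _ _) => [|k IHk] /=; first exact: connect0.
have [->//|/step_neq[-> _ _ _]] :=
  eqVneq (step hi 0 p (iter k (step hi 0 p) x)) (iter k (step hi 0 p) x).
exact: connect_trans IHk (fconnect1 _ _).
Qed.

Lemma fixpoint_exists hi m p x : admissible p ->
  exists2 r, fconnect (step hi m p) x r & step hi m p r = r.
Proof.
move=> vp; elim/ltn_ind: {x}(val x) {-2}x (erefl (val x)) => k IHk x xk.
have [fx|/step_neq[sx mp _ _]] := eqVneq (step hi m p x) x; first by exists x; rewrite ?connect0.
have [x0|x0] := posnP x.
  exists x; rewrite ?connect0 // (_ : x = ord0) ?step_root //; exact: val_inj.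
have := IHk (p x) _ _ (erefl _).
rewrite -xk -[_ < _]/(p x < x) (admissible_lt vp x0) => -/(_ isT)[r pr fr].
by exists r => //; apply: connect_trans pr; rewrite -sx fconnect1.
Qed.

Section Component.
Context (hi : pred 'I_n.+1) (p : parents n) (G : graph n.+1).
Context (vp : admissible p).
Context (adjE : forall x y, adj G x y =
  (x != y) && ((step hi 0 p x == y) || (step hi 0 p y == x))).

Local Notation f := (step hi 0 p).

(** Reaching [r] is invariant under adjacency: an edge joins a vertex to its image under [f], and a
    vertex that moves and reaches [r] is not the fixed point [r], so its image still reaches [r]. *)
Lemma component_branch r : f r = r -> component G r = branch hi 0 p r.
Proof.
move=> fr; apply/setP => x; rewrite !inE; apply/idP/idP.
  move=> rx; pose P y := fconnect f y r.
  apply: (connect_invariant (P := P) _ rx); last exact: connect0.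
  move=> y z; rewrite adjE => /andP[yz /orP[/eqP yz'|/eqP zy]] yr; last first.
    by rewrite /P -(zy) in yr *; exact: connect_trans (fconnect1 _ _) yr.
  rewrite /P -yz'; apply: fconnect_next => //.
  by apply: contraNneq yz => yr'; rewrite -yz' yr' fr.
rewrite connect_adjC => /iter_findex <-.
elim: (findex _ _ _) => [|k IHk] /=; first exact: connect0.
apply: connect_trans IHk _.
have [->|neq] := eqVneq (f (iter k f x)) (iter k f x); first exact: connect0.
by apply: connect1; rewrite adjE eq_sym neq eqxx.
Qed.

(** Once the root is deleted, reaching [c] is invariant under adjacency. A vertex reaching both [c]
    and [c'] would make one of them reach the other, whereas both step directly to the root, which
    is fixed. *)
Lemma separates_children c c' x x' : f c = ord0 -> f c' = ord0 ->
  c != ord0 -> c' != ord0 -> c != c' ->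
  x \in branch hi 0 p c -> x' \in branch hi 0 p c' -> separates G ord0 x x'.
Proof.
move=> fc fc' c0 c0' cc'; rewrite !inE => xc xc'.
have f0 := step_root hi 0 vp.
have conn a b : f b = ord0 -> fconnect f a b -> connect (adj G) ord0 a.
  move=> fb ab; have : a \in component G ord0; last by rewrite inE.
  by rewrite component_branch // inE (connect_trans ab) // -fb fconnect1.
rewrite /separates (conn _ _ fc xc) (conn _ _ fc' xc') /=.
apply/negP => xx'; pose P y := fconnect f y c.
have : P x'.
  apply: (connect_invariant (P := P) _ xx') => // y z.
  rewrite /adj_off adjE => /and3P[/andP[_ /orP[/eqP yz|/eqP zy]] y0 z0] yc; last first.
    by rewrite /P; apply: connect_trans yc; rewrite -zy fconnect1.
  rewrite /P -yz; apply: fconnect_next => //.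
  by apply: contraNneq z0 => yc'; rewrite -yz yc' fc.
move=> xc2; case/orP: (fconnect_linear xc2 xc') => [cc2|cc2].
  by have := fconnect_next cc2 cc'; rewrite fc => /(fconnect_fixed f0) e; rewrite e eqxx in c0'.
rewrite eq_sym in cc'.
by have := fconnect_next cc2 cc'; rewrite fc' => /(fconnect_fixed f0) e; rewrite e eqxx in c0.
Qed.

(** The root splits every triple with one vertex in each of three branches at its children. Each
    branch has at least the fraction [1 / d] of the component, whence the parameter [d ^ 3]. *)
Lemma root_set_criterion m d : 0 < m ->
  (forall t : 'I_n.+1, t < m -> hi t) ->
  (forall t, m <= t -> #|branch hi 0 p t| < #|branch hi 0 p ord0|) ->
  2 < #|[set c : 'I_n.+1 | [&& 0 < c, c < m, p c == ord0
        & #|branch hi 0 p ord0| <= d * #|branch hi 0 p c|]]| ->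
  ord0 \in root_set (d ^ 3) G.
Proof.
move=> m0 him ltm /card_gt2P[c1 [c2 [c3 [[C1 C2 C3] [c12 c23 c31]]]]].
have f0 := step_root hi 0 vp.
have hi0 : hi ord0 by exact: him.
have child (c : 'I_n.+1) : 0 < c -> c < m -> p c == ord0 -> f c = ord0.
  by move=> c0 cm /eqP pc; rewrite /step pc hi0 him.
rewrite inE; apply/andP; split.
  apply/forallP => w; have [//|ncw] := boolP (connect (adj G) ord0 w).
  (* The oldest vertex [r] of another component is at least [m]: among the first [m] vertices, all
     high, only the root is fixed. *)
  have [r wr fr] := fixpoint_exists hi 0 w vp.
  have wr' : connect (adj G) r w.
    have : w \in component G r by rewrite component_branch // inE.
    by rewrite inE.
  rewrite -(component_eq wr') !component_branch //= ; apply: ltm.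
  rewrite leqNgt; apply/negP => rm; case/negP: ncw.
  suff -> : ord0 = r by [].
  apply: val_inj; apply/eqP; rewrite /= eq_sym -leqn0 leqNgt; apply/negP => r0.
  have : f r = p r.
    by rewrite /step him // him //; apply: leq_ltn_trans rm; exact: admissible_le.
  by rewrite fr => e; have := admissible_lt vp r0; rewrite -e ltnn.
rewrite component_branch //.
move: C1 C2 C3; rewrite !inE => /and4P[p1 m1 q1 C1] /and4P[p2 m2 q2 C2] /and4P[p3 m3 q3 C3].
apply: (@leq_trans (d ^ 3 * #|setX (setX (branch hi 0 p c1) (branch hi 0 p c2))
                                   (branch hi 0 p c3)|)).
  rewrite !cardsX !expnS !expn0 !muln1 mulnA.
  apply: leq_trans (leq_mul (leq_mul C1 C2) C3) _.
  by rewrite leq_eqVlt; apply/orP; left; apply/eqP; ring.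
rewrite leq_mul2l; apply/orP; right; apply: subset_leq_card.
apply/subsetP => -[[x y] z]; rewrite !in_setX => /andP[/andP[/= xc yc] zc].
rewrite inE /=.
have nz (c : 'I_n.+1) : 0 < c -> c != ord0 by rewrite -val_eqE /= lt0n.
rewrite eq_sym in c31; apply/and3P; split.
- apply: separates_children (child _ p1 m1 q1) (child _ p2 m2 q2) _ _ _ xc yc; auto.
- apply: separates_children (child _ p1 m1 q1) (child _ p3 m3 q3) _ _ _ xc zc; auto.
- apply: separates_children (child _ p2 m2 q2) (child _ p3 m3 q3) _ _ _ yc zc; auto.
Qed.

End Component.

End Clusters.

(** * Decomposition and size of the clusters *)

Section ClusterBounds.
Local Open Scope nat_scope.
Context (n : nat) (hi : pred 'I_n.+1) (p : parents n).
Context (vp : admissible p).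
Implicit Types (m : nat) (x y t v : 'I_n.+1).

Lemma step_le m x : step hi m p x <= x.
Proof. by rewrite /step; case: ifP => // _; exact: admissible_le. Qed.

Lemma fconnect_le m x t : fconnect (step hi m p) x t -> t <= x.
Proof.
move=> /iter_findex <-; elim: (findex _ _ _) => //= k; apply: leq_trans.
exact: step_le.
Qed.

(** Parents are older, so a path ending at [t >= m] never goes below [m], and the cut at [m] removes
    none of its edges. *)
Lemma branchE m t : m <= t -> branch hi m p t = branch hi 0 p t.
Proof.
move=> mt; apply/setP => x; rewrite !inE; apply/idP/idP.
  move/iter_findex <-; elim: (findex _ _ _) => [|k IHk] /=; first exact: connect0.
  set z := iter _ _ _ in IHk *.
  have [->//|neq] := eqVneq (step hi m p z) z.
  have [-> _ h1 h2] := step_neq neq.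
  by apply: connect_trans IHk _; rewrite (_ : p z = step hi 0 p z) ?fconnect1 // /step h1 h2.
elim/ltn_ind: {x}(val x) {-2}x (erefl (val x)) => k IHk x xk xt.
have [->|neq] := eqVneq x t; first exact: connect0.
have xt' := fconnect_next xt neq.
have mx : m <= step hi 0 p x by apply: leq_trans mt _; exact: fconnect_le xt'.
have [fx|neq'] := eqVneq (step hi 0 p x) x.
  by rewrite (fconnect_fixed fx xt) connect0.
have [sx _ h1 h2] := step_neq neq'.
have lt : step hi 0 p x < k.
  by rewrite -xk ltn_neqAle step_le andbT val_eqE.
apply: connect_trans (IHk _ lt _ (erefl _) xt').
by rewrite sx in mx *; rewrite (_ : p x = step hi m p x) ?fconnect1 // /step mx h1 h2.
Qed.

Lemma fconnect_high m x c : (forall t : 'I_n.+1, t < m -> hi t) -> x < m ->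
  fconnect p x c -> fconnect (step hi 0 p) x c.
Proof.
move=> him xm /iter_findex <-; elim: (findex _ _ _) => [|k IHk] /=; first exact: connect0.
have km : iter k p x < m by apply: leq_ltn_trans (iter_le _ _ vp) xm.
apply: connect_trans IHk _.
rewrite (_ : p _ = step hi 0 p (iter k p x)) ?fconnect1 // /step !him //.
by apply: leq_ltn_trans km; exact: admissible_le.
Qed.

(** The path to the root from a cluster vertex outside the first [m] crosses level [m] along an edge
    from some [t] to [p t]; this edge is retained, so [t] is high. *)
Lemma branch_root_le m : 0 < m -> (forall t : 'I_n.+1, t < m -> hi t) ->
  #|branch hi 0 p ord0| <=
  m + \sum_(t : 'I_n.+1 | (m <= t) && (p t < m)) hi t * #|branch hi m p t|.
Proof.
move=> m0 him; pose P t := [&& m <= t, p t < m & hi t].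
have sub : branch hi 0 p ord0 \subset
    [set x : 'I_n.+1 | x < m] :|: \bigcup_(t | P t) branch hi m p t.
  apply/subsetP => x; elim/ltn_ind: {x}(val x) {-2}x (erefl (val x)) => k IHk x xk.
  rewrite !inE => x0; have [//|mx] := ltnP x m; rewrite /=.
  have [x00|xn0] := eqVneq x ord0.
    by move: mx; rewrite x00 leqNgt m0.
  have fx := fconnect_next x0 xn0.
  have [e|/step_neq[sx _ h1 h2]] := eqVneq (step hi 0 p x) x.
    by case/eqP: xn0; apply/esym; exact: fconnect_fixed e x0.
  have [pxm|mpx] := ltnP (p x) m.
    by apply/bigcupP; exists x; rewrite ?inE ?connect0 // /P mx pxm.
  have lt : p x < k.
    by rewrite -xk admissible_lt // lt0n; rewrite -val_eqE in xn0.
  have := IHk _ lt _ (erefl _); rewrite inE -sx => /(_ fx); rewrite sx.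
  rewrite !inE ltnNge mpx /= => /bigcupP[t Pt]; rewrite inE => pt.
  apply/bigcupP; exists t => //; rewrite inE; apply: connect_trans pt.
  by rewrite (_ : p x = step hi m p x) ?fconnect1 // /step mpx h1 h2.
apply: leq_trans (subset_leq_card sub) _; apply: leq_trans (leq_card_setU _ _) _.
apply: leq_add.
  rewrite -sum1_card; under eq_bigl do rewrite inE.
  have [mn|/ltnW nm] := leqP m n.+1.
    by rewrite -(big_ord_widen n.+1 (fun=> 1)) // sum1_card card_ord.
  by apply: leq_trans nm; rewrite sum1_card (leq_trans (max_card _)) ?card_ord.
apply: leq_trans (leq_card_bigcup _ _) _.
rewrite big_mkcond [X in _ <= X]big_mkcond; apply: leq_sum => t _; rewrite /P.
by case: (m <= t); case: (p t < m); case: (hi t); rewrite ?mul1n.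
Qed.

(** Each such [t] is a fixed point of [step hi m p], so the branches are disjoint. For high [t] the
    branch is joined to [c] through [p t] and the initial tree, all of whose vertices are high. *)
Lemma branch_child_ge m c : (forall t : 'I_n.+1, t < m -> hi t) ->
  \sum_(t : 'I_n.+1 | [&& m <= t, p t < m & fconnect p (p t) c]) hi t * #|branch hi m p t|
  <= #|branch hi 0 p c|.
Proof.
move=> him; pose P t := [&& m <= t, p t < m & fconnect p (p t) c] && hi t.
have -> : \sum_(t : 'I_n.+1 | [&& m <= t, p t < m & fconnect p (p t) c]) hi t * #|branch hi m p t|
  = \sum_(t : 'I_n.+1 | P t) #|branch hi m p t|.
  rewrite big_mkcond [RHS]big_mkcond; apply: eq_bigr => t _; rewrite /P.
  by case: (_ && _); case: (hi t); rewrite ?mul1n.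
have fixed t : P t -> step hi m p t = t.
  by case/andP=> /and3P[_ pt _] _; rewrite /step leqNgt pt.
rewrite -card_bigcup_disjoint; last first.
  move=> s t Ps Pt st; rewrite -setI_eq0; apply/eqP/setP => x; rewrite !inE.
  apply/negP => /andP[xs xt]; case/eqP: st.
  exact: fconnect_fixed_eq (fixed _ Ps) (fixed _ Pt) xs xt.
apply: subset_leq_card; apply/bigcupsP => t Pt; case/andP: Pt => /and3P[mt pt tc] ht.
rewrite branchE //; apply/subsetP => x; rewrite !inE => xt.
apply: connect_trans xt _; apply: connect_trans (fconnect_high him pt tc).
by rewrite (_ : p t = step hi 0 p t) ?fconnect1 // /step ht him.
Qed.

(** The strict bound on [indeg] leaves room for the root, which is its own parent without being
    counted by [indeg]. *)
Lemma card_iter_preim D k z : (forall v, indeg p v < D) ->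
  #|[set x | iter k p x == z]| <= D ^ k.
Proof.
move=> pD; elim: k z => [|k IHk] z.
  by rewrite (_ : [set _ | _] = [set z]) ?cards1 //; apply/setP => x; rewrite !inE.
have sub : [set x | iter k.+1 p x == z] \subset
    \bigcup_(y in [set y | p y == z]) [set x | iter k p x == y].
  apply/subsetP => x; rewrite inE /= => xz; apply/bigcupP.
  by exists (iter k p x); rewrite inE.
apply: leq_trans (subset_leq_card sub) _.
apply: leq_trans (leq_card_bigcup _ _) _.
apply: (@leq_trans (\sum_(y in [set y | p y == z]) D ^ k)); first exact: leq_sum.
rewrite sum_nat_const expnS leq_mul2r; apply/orP; right.
apply: leq_trans (pD z).
have sub2 : [set y | p y == z] \subset ord0 |: [set i | (p i < i) && (p i == z)].
  apply/subsetP => y; rewrite !inE => ->; rewrite andbT.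
  have [y0|y0] := posnP y; first by rewrite (_ : y = ord0) //; exact: val_inj.
  by rewrite admissible_lt // orbT.
apply: leq_trans (subset_leq_card sub2) _.
by rewrite cardsU1; case: (_ \notin _).
Qed.

Definition descendants t m : {set 'I_n.+1} := [set x : 'I_n.+1 | (x < m) && fconnect p x t].

(** Within [k] steps, a vertex of the branch either arrives at [t] or, for want of a chain, falls
    below [m] at a descendant of [t]. The branch is thus covered by iterated preimages of [t] and
    these descendants; the last successor accounts for [t]. *)
Lemma branch_card_le D k m t : 0 < D -> (forall v, indeg p v < D) ->
  ~~ [exists x, [forall i : 'I_k.+1, (m <= iter i p x) && hi (iter i p x)]] ->
  #|branch hi 0 p t| <= k.+1 * D ^ k * #|descendants t m|.+1.
Proof.
move=> D0 pD nochain; pose Z := t |: descendants t m.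
have sub : branch hi 0 p t \subset
    \bigcup_(i < k.+1) \bigcup_(z in Z) [set x | iter i p x == z].
  apply/subsetP => x; rewrite inE => xt.
  have iterE i : i <= findex (step hi 0 p) x t -> iter i (step hi 0 p) x = iter i p x.
    elim: i => //= i IHi ix; rewrite IHi ?(ltnW ix) //.
    have [e _ _ _] := step_neq (iter_findex_neq xt ix).
    by rewrite -IHi ?(ltnW ix).
  have [le|gt] := leqP (findex (step hi 0 p) x t) k.
    apply/bigcupP; exists (Ordinal (le : _ < k.+1)) => //.
    apply/bigcupP; exists t; first by rewrite !inE eqxx.
    by rewrite inE /= -iterE // iter_findex.
  move: nochain; rewrite negb_exists => /forallP/(_ x); rewrite negb_forall.
  case/existsP => i; rewrite -iterE; last by apply: leq_trans (ltnW gt); rewrite -ltnS.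
  have ix : i < findex (step hi 0 p) x t by apply: leq_trans gt; rewrite ltnS -ltnS.
  have [_ _ -> _] := step_neq (iter_findex_neq xt ix).
  rewrite andbT -ltnNge => im; apply/bigcupP; exists i => //.
  apply/bigcupP; exists (iter i (step hi 0 p) x); last by rewrite inE -iterE ?eqxx // ltnW.
  rewrite !inE im /=; apply/orP; right; apply: (@step_fconnect _ hi).
  have := fconnect_iter (step hi 0 p) (findex (step hi 0 p) x t - i)
                        (iter i (step hi 0 p) x).
  by rewrite -iterD subnK ?(ltnW ix) // iter_findex.
apply: leq_trans (subset_leq_card sub) _.
apply: leq_trans (leq_card_bigcup _ _) _.
apply: (@leq_trans (\sum_(i < k.+1) D ^ k * #|descendants t m|.+1)); last first.
  by rewrite sum_nat_const card_ord mulnA.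
apply: leq_sum => i _; apply: leq_trans (leq_card_bigcup _ _) _.
apply: (@leq_trans (\sum_(z in Z) D ^ k)).
  apply: leq_sum => z _; apply: leq_trans (card_iter_preim _ _ pD) _.
  by rewrite leq_pexp2l // -ltnS.
rewrite sum_nat_const mulnC leq_mul2l /Z cardsU1; apply/orP; right.
by case: (_ \notin _).
Qed.

End ClusterBounds.

(** The map [step hi m p] ignores which vertex below [m] a parent is. Clusters are thus unaffected
    when their attachments to the initial tree are resampled. *)
Lemma branch_eq_above n (hi hi' : pred 'I_n.+1) (p q : parents n) m t :
  (forall v : 'I_n.+1, (m <= v)%N -> hi v = hi' v) ->
  (forall v : 'I_n.+1, (p v = q v) \/ ((p v < m) && (q v < m))%N) ->
  admissible p -> branch hi m p t = branch hi' m q t.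
Proof.
move=> hh pq vp; apply/setP => x; rewrite !inE; apply: (@eq_fconnect _ _ _).
move=> y; rewrite /step; case: (pq y) => [<-|/andP[py qy]]; last first.
  by rewrite leqNgt py leqNgt qy.
case: leqP => //= my; rewrite !hh //; apply: leq_trans my _; exact: admissible_le.
Qed.

(** * Subtree sizes *)

Section Descendants.
Local Open Scope nat_scope.
Context (n : nat).
Implicit Types (p q : parents n) (x t : 'I_n.+1).

Lemma admissible_update p (s j : 'I_n.+1) : admissible p -> j < maxn 1 s ->
  admissible (update p s j).
Proof.
move=> /forallP vp js; apply/forallP => i; rewrite ffunE.
by case: eqP => [->|_]; [exact: js | exact: vp].
Qed.

(** The ancestors of a vertex below [m] are below [m]. Hence subtree sizes at time [m] are
    independent of the later coordinates. *)
Lemma descendants_local m p q t : admissible p ->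
  {in [pred x : 'I_n.+1 | x < m], p =1 q} -> descendants p t m = descendants q t m.
Proof.
move=> vp pq.
have iterE k x : x < m -> iter k p x = iter k q x.
  move=> xm; elim: k => //= k <-; apply: pq.
  by rewrite inE; apply: leq_ltn_trans (iter_le _ _ vp) xm.
apply/setP => x; rewrite !inE; case xm: (x < m) => //=.
apply/idP/idP => /iter_findex <-.
  by rewrite iterE // fconnect_iter.
by rewrite -iterE // fconnect_iter.
Qed.

Lemma descendant_ge p x t : admissible p -> fconnect p x t -> t <= x.
Proof. by move=> vp /iter_findex <-; exact: iter_le. Qed.

Lemma descendants_self p t : admissible p -> descendants p t t.+1 = [set t].
Proof.
move=> vp; apply/setP => x; rewrite !inE ltnS.
apply/andP/eqP => [[xt /(descendant_ge vp) tx]|->]; last by rewrite leqnn connect0.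
by apply: val_inj; apply/eqP; rewrite eqn_leq xt.
Qed.

Lemma card_descendants_gt0 p t i : t < i -> 0 < #|descendants p t i|.
Proof. by move=> ti; apply/card_gt0P; exists t; rewrite inE ti connect0. Qed.

Lemma card_ord_lt i : i <= n.+1 -> #|[set x : 'I_n.+1 | x < i]| = i.
Proof.
move=> il; rewrite -sum1_card; under eq_bigl do rewrite inE.
by rewrite -(big_ord_widen n.+1 (fun=> 1)) // sum1_card card_ord.
Qed.

Lemma card_descendants_lt p t i : admissible p -> 0 < t -> 0 < i -> i <= n.+1 ->
  #|descendants p t i| < i.
Proof.
move=> vp t0 i0 il; rewrite -[ltnRHS](card_ord_lt il); apply: proper_card.
apply/properP; split; first by apply/subsetP => x; rewrite !inE => /andP[].
exists ord0; rewrite inE // negb_and; apply/orP; right.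
by apply/negP => /(descendant_ge vp); rewrite leqNgt t0.
Qed.

Lemma card_descendants_next p t (i : 'I_n.+1) : admissible p -> t < i ->
  #|descendants p t i.+1| = #|descendants p t i| + (p i \in descendants p t i).
Proof.
move=> vp ti; have i0 : 0 < i by apply: leq_ltn_trans ti.
have -> : descendants p t i.+1 =
    descendants p t i :|: (if p i \in descendants p t i then [set i] else set0).
  apply/setP => x; rewrite !inE ltnS leq_eqVlt admissible_lt //=.
  have -> : (nat_of_ord x == i) = (x == i) by rewrite -val_eqE.
  have [->|xi] := eqVneq x i; last first.
    by rewrite /= orbC; case: ifP; rewrite !inE ?(negbTE xi).
  rewrite /= ltnn /=; have -> : fconnect p i t = fconnect p (p i) t.
    apply/idP/idP => [it|]; last exact: connect_trans (fconnect1 _ _).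
    by apply: fconnect_next => //; rewrite neq_ltn ti orbT.
  by case: ifP => _; rewrite !inE ?eqxx.
rewrite cardsU; case: ifP => _; last by rewrite cards0 setI0 cards0 subn0.
rewrite cards1 (_ : _ :&: _ = set0) ?cards0 ?subn0 //.
apply/setP => x; rewrite !inE; case: (eqVneq x i) => [->|]; last by rewrite andbF.
by rewrite ltnn.
Qed.

End Descendants.

(** * Subtree sizes as a Polya urn *)

Section SubtreeSizes.
Context (R : realType) (n : nat).
Implicit Types (p : parents n) (t : 'I_n.+1).

(** Vertex [i] joins a subtree of size [D] with probability [D / i]. An arbitrary test function [h]
    yields both the moments and the point probabilities. *)
Lemma Ex_descendants_next (h : nat -> R) t (i : 'I_n.+1) : (t < i)%N ->
  Ex (fun p => h #|descendants p t i.+1|) =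
  Ex (fun p => h #|descendants p t i| * (1 - #|descendants p t i|%:R / i%:R)
             + h #|descendants p t i|.+1 * (#|descendants p t i|%:R / i%:R)).
Proof.
move=> ti; have i0 : (0 < i)%N by apply: leq_ltn_trans ti.
rewrite (Ex_update i); apply: eq_Ex => p vp.
rewrite sum_attach_prob (maxn_idPr i0).
set D := descendants p t i.
have -> : \sum_(j : 'I_n.+1 | (j < i)%N) h #|descendants (update p i j) t i.+1| =
          \sum_(j in [set x : 'I_n.+1 | (x < i)%N]) h (#|D| + (j \in D))%N.
  under [RHS]eq_bigl do rewrite inE.
  apply: eq_bigr => j ji.
  have vq : admissible (update p i j).
    by apply: admissible_update => //; rewrite (maxn_idPr i0).
  rewrite card_descendants_next // ffunE eqxx.
  rewrite -(@descendants_local _ i p) // => x; rewrite inE => xi.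
  by rewrite ffunE -val_eqE /= ltn_eqF.
rewrite (big_setID D) /=.
have DI : [set x : 'I_n.+1 | (x < i)%N] :&: D = D.
  by apply/setIidPr/subsetP => x; rewrite !inE => /andP[].
rewrite DI (eq_bigr (fun=> h #|D|.+1)); last by move=> j ->; rewrite addn1.
rewrite [X in _ + X](eq_bigr (fun=> h #|D|)); last first.
  by move=> j; rewrite inE => /andP[/negbTE-> _]; rewrite addn0.
rewrite !sumr_const cardsD DI card_ord_lt ?(ltnW (ltn_ord i)) //.
have Di : (#|D| <= i)%N.
  rewrite -[leqRHS](@card_ord_lt n) ?(ltnW (ltn_ord i)) //; apply: subset_leq_card.
  by rewrite -DI subsetIl.
rewrite -[h #|D|.+1 *+ _]mulr_natr -[h #|D| *+ _]mulr_natr natrB //.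
by field; rewrite pnatr_eq0 -lt0n.
Qed.

Lemma Ex_descendants t i : (t < i <= n.+1)%N ->
  Ex (fun p => #|descendants p t i|%:R : R) = i%:R / t.+1%:R.
Proof.
elim: i => // i IHi; rewrite ltnS => /andP[ti il].
move: ti; rewrite leq_eqVlt => /orP[/eqP<-|ti].
  rewrite divff ?pnatr_eq0 // -[RHS](Ex_cst n); apply: eq_Ex => p vp.
  by rewrite descendants_self // cards1.
have i0 : (0 < i)%N by apply: leq_ltn_trans ti.
rewrite (@Ex_descendants_next (fun k => k%:R) t (Ordinal il)) //=.
transitivity (Ex (fun p => (1 + i%:R^-1) * (#|descendants p t i|%:R : R))).
  apply: eq_Ex => p _; rewrite -natr1; field.
  by rewrite pnatr_eq0 -lt0n.
rewrite ExZ IHi ?ti 1?ltnW // -natr1 -[i.+1%:R]natr1; field.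
by rewrite ?natr1 !pnatr_eq0; lia.
Qed.

(** The rising factorial [D (D + 1)] is an eigenfunction of the urn: each step multiplies its mean
    by exactly [1 + 2 / i], starting from 2 at time [t + 1]. *)
Lemma Ex_descendants2 t i : (t < i <= n.+1)%N ->
  Ex (fun p => #|descendants p t i|%:R * #|descendants p t i|.+1%:R : R) =
  2 * (i%:R * i.+1%:R) / (t.+1%:R * t.+2%:R).
Proof.
elim: i => // i IHi; rewrite ltnS => /andP[ti il].
move: ti; rewrite leq_eqVlt => /orP[/eqP<-|ti].
  rewrite mulfK; last by rewrite mulf_neq0 ?pnatr_eq0.
  rewrite -[RHS](Ex_cst n); apply: eq_Ex => p vp.
  by rewrite descendants_self // cards1 mul1r.
have i0 : (0 < i)%N by apply: leq_ltn_trans ti.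
rewrite (@Ex_descendants_next (fun k => k%:R * k.+1%:R) t (Ordinal il)) //=.
transitivity (Ex (fun p => (1 + 2 / i%:R) *
    (#|descendants p t i|%:R * #|descendants p t i|.+1%:R : R))).
  apply: eq_Ex => p _; rewrite -!natr1; field.
  by rewrite pnatr_eq0 -lt0n.
rewrite ExZ IHi ?ti 1?ltnW // -[i.+2%:R]natr1 -[i.+1%:R]natr1; field.
by rewrite -natrD nat1r !pnatr_eq0 -!lt0n i0.
Qed.

(* The transition kernel preserves a uniform bound on the mass function of the
   subtree size up to the factor [1 - 1/i]. *)
Lemma Pr_descendants_eq t i k : (0 < t)%N -> (t < i <= n.+1)%N ->
  Pr R (fun p => #|descendants p t i| == k) <= t%:R / i.-1%:R.
Proof.
move=> t0; elim: i k => // i IHi k; rewrite ltnS => /andP[ti il].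
move: ti; rewrite leq_eqVlt => /orP[/eqP<-|ti].
  rewrite divff ?pnatr_eq0 -?lt0n // -[leRHS](Ex_cst n); apply: le_Ex => p vp.
  by rewrite lern1 leq_b1.
have i0 : (0 < i)%N by apply: leq_ltn_trans ti.
have i1 : (1 < i)%N by apply: leq_ltn_trans ti.
have b0 (E : pred (parents n)) : (forall p, admissible p -> E p = false) ->
    Pr R E = 0.
  by move=> E0; rewrite -[RHS](Ex_cst n); apply: eq_Ex => p /E0 ->.
have [->|k0] := posnP k.
  rewrite b0 ?divr_ge0 // => p _; apply/negbTE; rewrite -lt0n.
  by apply: card_descendants_gt0; rewrite ltnW.
have [ik|ki] := ltnP i k.
  rewrite b0 ?divr_ge0 // => p vp; apply/negbTE.
  have := card_descendants_lt vp t0 (ltn0Sn i) il; rewrite ltnS.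
  by move=> /leq_ltn_trans/(_ ik); rewrite neq_ltn => ->.
rewrite /Pr (@Ex_descendants_next (fun l => (l == k)%:R) t (Ordinal il)) //=.
have iP : 0 < i%:R :> R by rewrite ltr0n.
have ki1 : k%:R / i%:R <= 1 :> R by rewrite ler_pdivrMr // mul1r ler_nat.
(* Size [k] comes from [k] without growth or from [k - 1] with growth; the two coefficients add up
   to [(i - 1) / i]. *)
apply: (@le_trans _ _ ((1 - k%:R / i%:R) * Pr R (fun p => #|descendants p t i| == k)
   + (k.-1%:R / i%:R) * Pr R (fun p => #|descendants p t i| == k.-1))).
  rewrite -!ExZ -ExD; apply: le_Ex => p _.
  rewrite -(prednK k0) eqSS.
  case: eqP => [->|_]; case: eqP => [e|_]; rewrite ?mul0r ?mulr0 ?mul1r ?mulr1 ?addr0 ?add0r //.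
    by exfalso; lia.
  by rewrite e.
have il' : (t < i <= n.+1)%N by rewrite ti ltnW.
apply: (@le_trans _ _ ((1 - k%:R / i%:R) * (t%:R / i.-1%:R) +
    k.-1%:R / i%:R * (t%:R / i.-1%:R))).
  apply: lerD; apply: ler_wpM2l; rewrite ?IHi ?subr_ge0 ?divr_ge0 //.
have -> : k%:R = k.-1%:R + 1 :> R by rewrite natr1 prednK.
have -> : i%:R = i.-1%:R + 1 :> R by rewrite natr1 prednK.
rewrite le_eqVlt; apply/orP; left; apply/eqP; field.
by rewrite natr1 !pnatr_eq0; lia.
Qed.

Lemma Pr_descendants_le t i k : (0 < t)%N -> (t < i <= n.+1)%N ->
  Pr R (fun p => (#|descendants p t i| <= k)%N) <= k.+1%:R * (t%:R / i.-1%:R).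
Proof.
move=> t0 ti.
apply: (@le_trans _ _ (Pr R (fun p => [exists j : 'I_k.+1,
   true && (#|descendants p t i| == j :> nat)]))).
  apply: Pr_sub => p vp le; apply/existsP; exists (Ordinal (le : (_ < k.+1)%N)).
  by rewrite eqxx.
apply: le_trans (Pr_exists _ _ _) _.
apply: (@le_trans _ _ (\sum_(j < k.+1) (t%:R / i.-1%:R))).
  by apply: ler_sum => j _; exact: Pr_descendants_eq.
by rewrite sumr_const card_ord [leRHS]mulr_natl.
Qed.

End SubtreeSizes.

(** * Degree tails *)

Section Degrees.
Context (R : realType).
Implicit Types (a b k m n : nat).

(** Each term satisfies [1 / s <= - ln (1 - 1 / s)], and the right-hand sides telescope. *)
Lemma harmonic_le a b : (0 < a <= b)%N ->
  \sum_(0 <= s < b.+1 | (a < s)%N) s%:R^-1 <= ln (b%:R / a%:R) :> R.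
Proof.
move=> /andP[a0]; elim: b => [|b IHb]; first by lia.
rewrite leq_eqVlt => /orP[/eqP<-|]; last rewrite ltnS => ab.
  rewrite divff ?pnatr_eq0 -?lt0n // ln1 big_nat_cond big_pred0 // => s.
  by apply/negbTE; lia.
have b0 : (0 < b)%N by apply: leq_trans ab.
have [B0 B1 A0] : [/\ 0 < b%:R :> R, 0 < b.+1%:R :> R & 0 < a%:R :> R].
  by rewrite !ltr0n.
rewrite big_mkcond big_nat_recr //= -big_mkcond /= ltnS ab.
rewrite (_ : b.+1%:R / a%:R = b%:R / a%:R / (b%:R / b.+1%:R)); last first.
  by field; rewrite ?nat1r !pnatr_eq0; lia.
rewrite ln_div ?posrE ?divr_gt0 // lerD ?IHb // lerNr.
rewrite (_ : b%:R / _ = 1 + - b.+1%:R^-1); last first.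
  by rewrite -natr1; field; rewrite natr1 pnatr_eq0.
by apply: le_ln1Dx; rewrite ltrN2 invf_lt1 // ltr1n.
Qed.

Lemma harmonic_ge a b : (0 < a <= b)%N ->
  ln (b%:R / a%:R) <= \sum_(a <= s < b) s%:R^-1 :> R.
Proof.
move=> /andP[a0]; elim: b => [|b IHb]; first by lia.
rewrite leq_eqVlt => /orP[/eqP<-|]; last rewrite ltnS => ab.
  by rewrite divff ?pnatr_eq0 -?lt0n // ln1 big_geq.
have b0 : (0 < b)%N by apply: leq_trans ab.
have [B0 B1 A0] : [/\ 0 < b%:R :> R, 0 < b.+1%:R :> R & 0 < a%:R :> R].
  by rewrite !ltr0n.
rewrite big_nat_recr //=.
rewrite (_ : b.+1%:R / a%:R = b%:R / a%:R * (1 + b%:R^-1)); last first.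
  by rewrite -natr1; field; rewrite !pnatr_eq0; lia.
rewrite lnM ?posrE ?divr_gt0 ?addr_gt0 ?invr_gt0 // lerD ?IHb //.
by apply: le_ln1Dx; apply: lt_trans (_ : 0 < _); rewrite ?invr_gt0 // oppr_lt0.
Qed.

Lemma expRN_ge (x : R) : 0 <= x -> x / (1 + x) <= 1 - expR (- x).
Proof.
move=> x0; have x1 : 0 < 1 + x by lra.
rewrite (_ : x / (1 + x) = 1 - (1 + x)^-1); last by field; lra.
by rewrite lerD2l lerN2 expRN lef_pV2 ?posrE ?expR_gt0 // expR_ge1Dx.
Qed.

Lemma expR_le_geom (x : R) : 0 <= x -> x < 1 -> expR x - 1 <= x / (1 - x).
Proof.
move=> x0 x1; rewrite (_ : x / (1 - x) = (1 - x)^-1 - 1); last by field; lra.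
rewrite lerD2r -[x in X in X <= _]opprK expRN lef_pV2 ?posrE ?expR_gt0 ?subr_gt0 //.
exact: expR_ge1Dx.
Qed.

Section Fixed.
Context (n : nat).
Implicit Types (p : parents n) (v : 'I_n.+1).

Definition hits p (S : pred 'I_n.+1) v : nat := #|[set s | S s && (p s == v)]|.

Lemma sum_attach_indicator (s : 'I_n.+1) (A : {set 'I_n.+1}) (y : R) :
  \sum_j attach_prob R s j * (if j \in A then y else 1) =
  1 + (y - 1) * \sum_(j in A) attach_prob R s j.
Proof.
rewrite -[X in X + _](@attach_prob_sum1 R n s) big_distrr [X in _ + X]big_mkcond.
rewrite -big_split /=; apply: eq_bigr => j _; case: ifP => _; last by rewrite mulr1 addr0.
by ring.
Qed.

Lemma Ex_expr_hits (S : pred 'I_n.+1) v (y : R) :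
  Ex (fun p => y ^+ hits p S v) =
  \prod_(s | S s) (1 + (y - 1) * attach_prob R s v).
Proof.
transitivity (Ex (fun p => \prod_s (if S s && (p s == v) then y else 1))).
  apply: eq_Ex => p _; rewrite -big_mkcond /= prodr_const.
  by congr (_ ^+ _); apply: eq_card => s; rewrite inE.
rewrite (Ex_prod (fun s j => if S s && (j == v) then y else 1)).
rewrite [RHS]big_mkcond; apply: eq_bigr => s _; case: (S s) => /=; last first.
  by under eq_bigr do rewrite mulr1; exact: attach_prob_sum1.
have <- : \sum_(j in [set v]) attach_prob R s j = attach_prob R s v by rewrite big_set1.
rewrite -sum_attach_indicator.
by apply: eq_bigr => j _; rewrite inE.
Qed.

(** The left-hand side is the mean number of children of [v]. *)
Lemma sum_attach_prob_col v : (0 < v)%N ->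
  \sum_s attach_prob R s v <= ln (n.+1%:R / v%:R).
Proof.
move=> v0; have vn : (v <= n)%N by rewrite -ltnS.
apply: (@le_trans _ _ (ln (n%:R / v%:R))); last first.
  rewrite ler_ln ?posrE ?divr_gt0 ?ltr0n // ?(leq_trans v0) //.
  by rewrite ler_pM2r ?invr_gt0 ?ltr0n // ler_nat.
apply: le_trans (harmonic_le _); last by rewrite v0.
rewrite big_mkord [leRHS]big_mkcond; apply: ler_sum => s _ /=.
rewrite /attach_prob; have [s0|s0] := posnP s; first by rewrite s0 /= ltnS leqn0 eqn0Ngt v0 mul0r.
by rewrite (maxn_idPr s0); case: ltnP; rewrite ?mul0r ?mul1r.
Qed.

Lemma prod_le_expR (I : finType) (P : pred I) (f : I -> R) :
  (forall i, P i -> 0 <= 1 + f i) ->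
  \prod_(i | P i) (1 + f i) <= expR (\sum_(i | P i) f i).
Proof.
by move=> f0; rewrite expR_sum; apply: ler_prod => i Pi; rewrite f0 // expR_ge1Dx.
Qed.

Lemma attach_prob_le1 (i j : 'I_n.+1) : attach_prob R i j <= 1.
Proof.
by apply: le_trans (attach_prob_le _ _ _) _; rewrite invf_le1 ?ltr0n ?ler1n leq_max.
Qed.

(** Chernoff bound with weight [exp (- theta)] per hit. The mean is at least [ln (b / a)], and
    [1 - exp (- theta)] is replaced by the rational lower bound [theta / (1 + theta)]. *)
Lemma lower_tail a b v (theta kappa : R) : 0 <= theta ->
  (v < a)%N -> (a <= b <= n.+1)%N ->
  Pr R (fun p => (hits p [pred s : 'I_n.+1 | (a <= s < b)%N] v)%:R <= kappa) <=
  expR (theta * kappa - theta / (1 + theta) * ln (b%:R / a%:R)).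
Proof.
move=> th0 va /andP[ab bn]; set S := [pred s : 'I_n.+1 | _].
have a0 : (0 < a)%N by apply: leq_ltn_trans va.
set y := expR (- theta).
have y1 : y <= 1 by rewrite /y expR_le1 oppr_le0.
have y0 : 0 < y := expR_gt0 _.
apply: (@le_trans _ _ (Ex (fun p => y ^+ hits p S v) / expR (- theta * kappa))).
  apply: markov => [|p _|p _ le]; rewrite ?expR_gt0 ?exprn_ge0 ?(ltW y0) //.
  by rewrite /y -expRM_natr ler_expR !mulNr lerN2 ler_wpM2l.
rewrite mulNr expRN invrK Ex_expr_hits expRD mulrC ler_wpM2l ?expR_ge0 //.
apply: le_trans (prod_le_expR _) _ => [s _|].
  have := attach_prob_le1 s v; have := attach_prob_ge0 R s v.
  move: (attach_prob R s v) => w w0 w1; nra.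
rewrite ler_expR -big_distrr /= -[y - 1]opprB mulNr lerN2.
apply: ler_pM.
- by rewrite divr_ge0 //; lra.
- by rewrite ln_ge0 // ler_pdivlMr ?ltr0n // mul1r ler_nat.
- exact: expRN_ge.
apply: le_trans (harmonic_ge _) _; first by rewrite a0.
rewrite (@big_nat_widenl _ _ _ a 0) // (@big_nat_widen _ _ _ 0 b n.+1) // big_mkord.
rewrite [leLHS](eq_bigl S); last by move=> s; rewrite /= andbC.
apply: ler_sum => s /andP[as_ sb]; rewrite /attach_prob.
have s0 : (0 < s)%N by apply: leq_trans as_.
by rewrite (maxn_idPr s0) (leq_trans va) // mul1r.
Qed.

Lemma sum_inv_le : \sum_(s : 'I_n.+1 | (0 < s)%N) s%:R^-1 <= 1 + ln n.+1%:R :> R.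
Proof.
rewrite -(big_mkord (fun s => 0 < s)%N (fun s => s%:R^-1)).
have [->|n0] := posnP n.
  by rewrite big_nat_cond big_pred0 ?ln1 ?addr0 // => s; case: s.
have le_log := @harmonic_le 1 n; rewrite n0 in le_log; move: (le_log isT) => {}le_log.
rewrite big_ltn_cond //= big_ltn_cond //= in le_log.
rewrite big_ltn_cond //= big_ltn_cond //= invr1; apply: lerD => //.
apply: (@le_trans _ _ (ln (n%:R / 1%:R))); last first.
  by rewrite divr1 ler_ln ?posrE ?ltr0n // ler_nat.
apply: le_trans le_log; rewrite big_nat_cond [leRHS]big_nat_cond.
rewrite le_eqVlt; apply/orP; left; apply/eqP.
by apply: eq_bigl => -[|[|s]].
Qed.

Lemma sum_inv_max_le : \sum_(a < n.+1) (maxn 1 a)%:R^-1 <= 2 + ln n.+1%:R :> R.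
Proof.
rewrite (bigID (fun a : 'I_n.+1 => (0 < a)%N)) /= addrC.
rewrite (_ : 2 = 1 + 1) // -addrA; apply: lerD.
  rewrite (eq_bigl (pred1 ord0)); last by move=> a; rewrite -leqNgt leqn0 /= -val_eqE.
  by rewrite big_pred1_eq invr1.
apply: le_trans sum_inv_le; apply: ler_sum => a a0.
by rewrite (maxn_idPr a0).
Qed.

(** Chernoff bound with weight [exp (1 / 2)] per child; as this is at most 2, the exponent is at
    most the sum of the attachment probabilities. *)
Lemma upper_tail v (kappa : R) :
  Pr R (fun p => kappa <= (indeg p v)%:R) <= expR (1 + ln n.+1%:R - kappa / 2).
Proof.
pose S : pred 'I_n.+1 := [pred s : 'I_n.+1 | (0 < s)%N].
set y : R := expR 2^-1.
have y2 : 1 <= y <= 2.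
  have half : 2^-1 / (1 - 2^-1) = 1 :> R by field.
  have : expR 2^-1 - 1 <= 1 :> R by rewrite -[leRHS]half; apply: expR_le_geom; lra.
  by move: (expR_ge1Dx (2^-1 : R)); rewrite -/y => ? ?; apply/andP; split; lra.
apply: (@le_trans _ _ (Ex (fun p => y ^+ hits p S v) / expR (kappa / 2))).
  apply: markov => [|p _|p vp le]; rewrite ?expR_gt0 ?exprn_ge0 ?(ltW (expR_gt0 _)) //.
  have -> : hits p S v = indeg p v.
    apply: eq_card => s; rewrite !inE /S /=; have [s0|s0] := posnP s; last by rewrite admissible_lt.
    by rewrite s0 !ltn0.
  by rewrite /y -expRM_natr ler_expR mulrC ler_wpM2l.
rewrite Ex_expr_hits -expRN [in leRHS]expRD ler_wpM2r ?expR_ge0 //.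
case/andP: y2 => y1 y2.
apply: le_trans (prod_le_expR _) _ => [s _|].
  by have := attach_prob_ge0 R s v; move: (attach_prob R s v) => w w0; nra.
rewrite ler_expR -big_distrr /=.
apply: (@le_trans _ _ (\sum_(s | S s) attach_prob R s v)).
  by rewrite ler_piMl ?sumr_ge0 // => [s _|]; [exact: attach_prob_ge0 | lra].
apply: (@le_trans _ _ (\sum_(s : 'I_n.+1 | (0 < s)%N) (s%:R^-1))).
  apply: ler_sum => s s0; apply: le_trans (attach_prob_le _ _ _) _.
  by rewrite (maxn_idPr s0).
exact: sum_inv_le.
Qed.

(** * Chains of high vertices *)

Section Chain.
Context (k m : nat) (v : {ffun 'I_k.+1 -> 'I_n.+1}).
Context (v_inj : injective v) (m_gt0 : (0 < m)%N) (mv : forall i, (m <= v i)%N).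

Let A : {set 'I_n.+1} := [set v i | i : 'I_k.+1].
Let from (i : 'I_k) : 'I_n.+1 := v (widen_ord (leqnSn k) i).
Let to (i : 'I_k) : 'I_n.+1 := v (lift ord0 i).

Let from_inj : injective from.
Proof. by move=> i j /v_inj/(congr1 val) /= ij; apply: val_inj. Qed.

Let prod_from (F : 'I_k -> 'I_n.+1 -> R) :
  \prod_s \prod_(i < k) (if from i == s then F i s else 1) =
  \prod_(i < k) F i (from i).
Proof.
rewrite exchange_big; apply: eq_bigr => i _ /=.
by rewrite -big_mkcond (big_pred1 (from i)) // => s; rewrite eq_sym.
Qed.

(** The integrand is a product over coordinates. A coordinate [s] on the path has its value
    prescribed, inside [A], and contributes at most [y / s]; any other contributes at most the
    exponential of [y - 1] times its probability of landing in [A]. *)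
Lemma Ex_chain (y : R) : 1 <= y ->
  Ex (fun p => (\prod_(i < k) (p (from i) == to i)%:R) * y ^+ #|[set s | p s \in A]|) <=
  y ^+ k * (\prod_(i < k) (from i)%:R^-1)
  * expR ((y - 1) * (k.+1%:R * ln (n.+1%:R / m%:R))).
Proof.
move=> y1; have y0 : 0 <= y by lra.
pose g (s a : 'I_n.+1) : R := (\prod_(i < k) (if from i == s then (a == to i)%:R else 1))
                  * (if a \in A then y else 1).
have -> : Ex (fun p => (\prod_(i < k) (p (from i) == to i)%:R)
             * y ^+ #|[set s | p s \in A]|) = Ex (fun p => \prod_s g s (p s)).
  apply: eq_Ex => p _; rewrite big_split /= prod_from -big_mkcond /= prodr_const.
  by congr (_ * _ ^+ _); apply: eq_card => s; rewrite inE.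
rewrite Ex_prod.
apply: (@le_trans _ _ (\prod_s ((\prod_(i < k) (if from i == s then y / s%:R else 1))
    * expR ((y - 1) * \sum_(a in A) attach_prob R s a)))).
  apply: ler_prod => s _; apply/andP; split.
    apply: sumr_ge0 => a _; rewrite mulr_ge0 ?attach_prob_ge0 // mulr_ge0 //.
      by apply: prodr_ge0 => i _; case: ifP => _; rewrite ?ler01.
    by case: ifP => _; rewrite ?ler01.
  have [i0 /eqP i0s|nos] := pickP (fun i => from i == s); last first.
    rewrite [X in _ <= X * _]big1 ?mul1r => [|i _]; last by rewrite nos.
    apply: le_trans (expR_ge1Dx _); rewrite -sum_attach_indicator.
    apply: ler_sum => a _; rewrite /g big1 ?mul1r // => i _; by rewrite nos.
  have single (F : 'I_k -> R) : \prod_(i < k) (if from i == s then F i else 1) = F i0.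
    rewrite (bigD1 i0) //= i0s eqxx big1 ?mulr1 // => i ii0.
    by rewrite -i0s (inj_eq from_inj) (negbTE ii0).
  rewrite single; apply: (@le_trans _ _ (y / s%:R)); last first.
    apply: ler_peMr; first by rewrite divr_ge0.
    rewrite -[leLHS]expR0 ler_expR mulr_ge0 ?subr_ge0 ?sumr_ge0 // => a _.
    exact: attach_prob_ge0.
  rewrite (bigD1 (to i0)) //= big1 ?addr0; last first.
    by move=> a /negbTE ato; rewrite /g single ato mul0r mulr0.
  have toA : to i0 \in A by apply: imset_f.
  rewrite /g single eqxx mul1r toA mulrC ler_wpM2l //.
  apply: le_trans (attach_prob_le _ _ _) _; rewrite (maxn_idPr _) //.
  by apply: leq_trans m_gt0 _; rewrite -i0s; exact: mv.
rewrite big_split /= (prod_from (fun i s => y / s%:R)) big_split /= prodr_const card_ord.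
rewrite ler_wpM2l //.
  by rewrite mulr_ge0 ?exprn_ge0 // prodr_ge0 // => i _; rewrite invr_ge0.
rewrite -expR_sum ler_expR -big_distrr /= ler_wpM2l ?subr_ge0 // exchange_big /=.
apply: (@le_trans _ _ (\sum_(a in A) ln (n.+1%:R / m%:R))).
  apply: ler_sum => _ /imsetP[i _ ->].
  have vi0 : (0 < v i)%N by apply: leq_trans m_gt0 _; exact: mv.
  apply: le_trans (sum_attach_prob_col vi0) _.
  rewrite ler_ln ?posrE ?divr_gt0 ?ltr0n // ler_pM2l ?ltr0n //.
  by rewrite lef_pV2 ?posrE ?ltr0n // ler_nat.
by rewrite sumr_const card_imset // card_ord [leRHS]mulr_natl.
Qed.

(** The chain has at least [k.+1 * (kappa - 1)] children in total, one edge per vertex leading to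
    its parent; Markov's inequality applies to [y] to this count. The term [2 * theta] pays for this
    shift and for the [k] children lying on the path. *)
Lemma Pr_chain (theta kappa : R) : 0 <= theta ->
  Pr R (fun p => [forall i : 'I_k, p (from i) == to i]
     && [forall i, kappa < (deg (tree p) (v i))%:R]) <=
  \prod_(i < k) (from i)%:R^-1 *
  expR (k.+1%:R * (2 * theta - theta * kappa
        + (expR theta - 1) * ln (n.+1%:R / m%:R))).
Proof.
move=> th0; set y := expR theta.
have y1 : 1 <= y by rewrite -[leLHS]expR0 ler_expR.
apply: (@le_trans _ _ (Ex (fun p => (\prod_(i < k) (p (from i) == to i)%:R)
    * y ^+ #|[set s | p s \in A]|) / expR (k.+1%:R * (theta * (kappa - 1))))).
  apply: markov => [|p _|p vp /andP[/forallP pv /forallP high]]; first exact: expR_gt0.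
    rewrite mulr_ge0 ?exprn_ge0 ?prodr_ge0 //; lra.
  rewrite big1 ?mul1r => [|i _]; last by rewrite pv.
  rewrite /y -expRM_natr ler_expR mulrCA ler_wpM2l //.
  apply: (@le_trans _ _ (\sum_(a in A) indeg p a)%:R).
    rewrite natr_sum -[k.+1]card_ord -(card_imset predT v_inj) mulr_natl -sumr_const.
    apply: ler_sum => a /imsetP[i _ ->].
    have := high i; rewrite deg_tree // (leq_trans m_gt0 (mv i)) natrD.
    by move=> /ltW; rewrite lerBlDr.
  rewrite ler_nat -card_bigcup_disjoint; last first.
    move=> a b _ _ ab; rewrite -setI_eq0; apply/eqP/setP => s; rewrite !inE.
    by apply/negP => /andP[/andP[_ /eqP->] /andP[_]]; apply/negP.
  apply: subset_leq_card; apply/bigcupsP => a aA; apply/subsetP => s; rewrite !inE.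
  by case/andP=> _ /eqP->.
rewrite ler_pdivrMr ?expR_gt0 //; apply: le_trans (Ex_chain y1) _.
rewrite -[leRHS]mulrA mulrAC -expRD mulrC ler_wpM2l //.
  by rewrite prodr_ge0 // => i _; rewrite invr_ge0.
rewrite /y -expRM_natl -expRD ler_expR -natr1.
have : 0 <= theta by [].
set l := ln _; nra.
Qed.

End Chain.

(** Union bound over injective sequences. Each of the first [k] vertices carries a weight summing to
    at most [2 + ln n.+1]; the last one is free, whence the factor [n.+1]. *)
Lemma chain_bound k m (theta kappa : R) : 0 <= theta -> (0 < m)%N ->
  Pr R (fun p => [exists x, [forall i : 'I_k.+1,
      (m <= iter i p x)%N && (kappa < (deg (tree p) (iter i p x))%:R)]]) <=
  n.+1%:R * (2 + ln n.+1%:R) ^+ k *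
  expR (k.+1%:R * (2 * theta - theta * kappa
        + (expR theta - 1) * ln (n.+1%:R / m%:R))).
Proof.
move=> th0 m0.
pose V (v : {ffun 'I_k.+1 -> 'I_n.+1}) := injectiveb v && [forall i, (m <= v i)%N].
pose E (v : {ffun 'I_k.+1 -> 'I_n.+1}) (p : parents n) :=
  [forall i : 'I_k, p (v (widen_ord (leqnSn k) i)) == v (lift ord0 i)]
     && [forall i, kappa < (deg (tree p) (v i))%:R].
apply: (@le_trans _ _ (Pr R (fun p => [exists v, V v && E v p]))).
  apply: Pr_sub => p vp /existsP[x /forallP high]; apply/existsP.
  (* Iterates that stay at or above [m > 0] decrease strictly, so the chain is injective. *)
  have dec i d : (i + d < k)%N -> (iter (i + d).+1 p x < iter i p x)%N.
    move=> idk; have lt1 j : (j <= k)%N -> (iter j.+1 p x < iter j p x)%N.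
      move=> jk; apply: admissible_lt => //.
      by have /andP[h _] := high (Ordinal (jk : (j < k.+1)%N)); apply: leq_trans h.
    elim: d idk => [|d IHd] idk; first by rewrite addn0; apply: lt1; rewrite ltnW // -(addn0 i).
    rewrite addnS in idk *; apply: ltn_trans (lt1 _ (ltnW idk)) (IHd _); exact: ltnW.
  have ne i j : (i < j <= k)%N -> iter i p x != iter j p x.
    move=> /andP[ij jk]; rewrite neq_ltn; apply/orP; right.
    by have := dec i (j - i.+1)%N; rewrite -addnS subnSK // subnKC ?(ltnW ij) //; apply; lia.
  exists [ffun i : 'I_k.+1 => iter i p x]; rewrite /V /E.
  apply/andP; split; apply/andP; split.
  - apply/injectiveP => i j; rewrite !ffunE => ij; apply: val_inj.
    case: (ltngtP i j) => // lt; [have := @ne i j|have := @ne j i];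
      by rewrite lt -ltnS ltn_ord ij eqxx => /(_ isT).
  - by apply/forallP => i; rewrite ffunE; case/andP: (high i).
  - by apply/forallP => i; rewrite !ffunE /=.
  - by apply/forallP => i; rewrite ffunE; case/andP: (high i).
apply: le_trans (Pr_exists _ _ _) _; set X := expR _.
apply: (@le_trans _ _ (\sum_(v | V v)
   (\prod_(i < k) (maxn 1 (v (widen_ord (leqnSn k) i)))%:R^-1) * X)).
  apply: ler_sum => v /andP[/injectiveP v_inj /forallP mv].
  apply: le_trans (Pr_chain v_inj m0 mv _ th0) _.
  rewrite ler_wpM2r ?expR_ge0 //; apply: ler_prod => i _; rewrite invr_ge0 ler0n /=.
  by rewrite (maxn_idPr _) //; apply: leq_trans m0 _; exact: mv.
rewrite -big_distrl /= ler_wpM2r ?expR_ge0 //.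
pose c (i : 'I_k.+1) (a : 'I_n.+1) : R := if (i < k)%N then (maxn 1 a)%:R^-1 else 1.
apply: (@le_trans _ _ (\sum_(v : {ffun 'I_k.+1 -> 'I_n.+1}) \prod_i c i (v i))).
  rewrite big_mkcond; apply: ler_sum => v _; case: ifP => _; last first.
    by apply: prodr_ge0 => i _; rewrite /c; case: ifP.
  rewrite big_ord_recr /= {2}/c ltnn mulr1 le_eqVlt; apply/orP; left; apply/eqP.
  by apply: eq_bigr => i _; rewrite /c /= ltn_ord.
rewrite -bigA_distr_bigA big_ord_recr /= mulrC.
rewrite [X in X * _](eq_bigr (fun=> 1)); last by move=> a _; rewrite /c ltnn.
rewrite sumr_const card_ord ler_wpM2l ?ler0n // -[k in leRHS]card_ord -prodr_const.
apply: ler_prod => i _; apply/andP; split.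
  by apply: sumr_ge0 => a _; rewrite /c; case: ifP.
rewrite (eq_bigr (fun a : 'I_n.+1 => (maxn 1 a)%:R^-1)); last first.
  by move=> a _; rewrite /c /= ltn_ord.
exact: sum_inv_max_le.
Qed.

End Fixed.
End Degrees.

(** * Concentration of the branches at the root *)

Section Chebyshev.
Context (R : realType) (n : nat) (kappa : R) (m : nat) (c : 'I_n.+1).
Context (m_le : (m <= n.+1)%N) (c_lt : (c < m)%N).
Implicit Types (p q : parents n) (s t v j : 'I_n.+1).

Definition high p : pred 'I_n.+1 := fun v => kappa < (deg (tree p) v)%:R.

(** What [t] brings to the vertex it is attached to: a low [t] keeps no edge to its parent and
    brings nothing. *)
Definition mass p t : nat := high p t * #|branch (high p) m p t|.

Definition total_mass p : nat := \sum_(t : 'I_n.+1 | (m <= t)%N && (p t < m)%N) mass p t.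

Definition mass_above p : nat :=
  \sum_(t : 'I_n.+1 | [&& m <= t, p t < m & fconnect p (p t) c]%N) mass p t.

Definition square_mass p : nat :=
  \sum_(t : 'I_n.+1 | (m <= t)%N && (p t < m)%N) mass p t ^ 2.

Let A p := descendants p c m.

(** A centred indicator: given [p t < m], the parent of [t] is uniform on the first [m] vertices, of
    which the fraction [#|A p| / m] descends from [c]. *)
Let b p t : R := (p t < m)%:R * ((p t \in A p)%:R - #|A p|%:R / m%:R).

Let m_gt0 : (0 < m)%N := leq_ltn_trans (leq0n c) c_lt.

(** Moving the parent of [s] among the vertices below [m] changes neither the degrees of the
    vertices from [m] on nor the steps cut at [m]. *)
Lemma mass_update p s j t : admissible p -> (m <= s)%N -> (j < m)%N -> (m <= t)%N ->
  mass (update p s j) t = mass (update p s ord0) t.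
Proof.
move=> vp ms jm mt.
have s0 : (0 < s)%N by apply: leq_trans ms.
have vq (i : 'I_n.+1) : (i < m)%N -> admissible (update p s i).
  by move=> im; apply: admissible_update; rewrite // (maxn_idPr s0) (leq_trans im).
have hiE (v : 'I_n.+1) : (m <= v)%N -> high (update p s j) v = high (update p s ord0) v.
  move=> mv; rewrite /high !deg_tree ?vq //; congr (_ < (_ + _)%:R).
  apply: eq_card => i; rewrite !inE !ffunE; case: eqP => // _.
  have ne (x : 'I_n.+1) : (x < m)%N -> (x == v) = false.
    by move=> xm; apply/negbTE; rewrite neq_ltn (leq_trans xm mv).
  by rewrite !ne ?andbF.
rewrite /mass hiE //; congr (_ * _)%N.
rewrite (@branch_eq_above _ _ (high (update p s ord0)) _ (update p s ord0)) ?vq //.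
move=> v; rewrite !ffunE; case: eqP => _; last by left.
by right; rewrite jm m_gt0.
Qed.

Lemma cond_update p s j t : (j < m)%N ->
  (update p s j t < m)%N = (update p s ord0 t < m)%N.
Proof. by move=> jm; rewrite !ffunE; case: eqP => // _; rewrite jm m_gt0. Qed.

Lemma total_mass_update p s j : admissible p -> (m <= s)%N -> (j < m)%N ->
  total_mass (update p s j) = total_mass (update p s ord0).
Proof.
move=> vp ms jm; apply: eq_big => [t|t /andP[mt _]]; first by rewrite cond_update.
exact: mass_update.
Qed.

Lemma square_mass_update p s j : admissible p -> (m <= s)%N -> (j < m)%N ->
  square_mass (update p s j) = square_mass (update p s ord0).
Proof.
move=> vp ms jm; apply: eq_big => [t|t /andP[mt _]]; first by rewrite cond_update.
by rewrite mass_update.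
Qed.

Let A_update p s j : admissible p -> (m <= s)%N -> A (update p s j) = A p.
Proof.
move=> vp ms; apply/esym/descendants_local => // x; rewrite inE => xm.
rewrite ffunE; case: eqP => // xs; move: xm; rewrite xs ltnNge ms //.
Qed.

Section Deviation.
Context (tau : R).

(** Normalization by the square of the total mass, truncated to the event where the squares are
    negligible. It is invariant under the resampling above, so Chebyshev's inequality works with
    random masses without conditional expectations. *)
Let H p : R := if (0 < total_mass p)%N && ((square_mass p)%:R <= tau * (total_mass p)%:R ^+ 2)
           then (total_mass p)%:R ^- 2 else 0.

Let H_ge0 p : 0 <= H p.
Proof. by rewrite /H; case: ifP => // _; rewrite invr_ge0 exprn_ge0. Qed.

(* Given everything else, the parent of [s] is uniform on the first [m] vertices. *)
Let cross_term s t : (m <= s)%N -> (m <= t)%N -> s != t ->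
  Ex (fun p => (mass p s)%:R * b p s * ((mass p t)%:R * b p t) * H p) = 0.
Proof.
move=> ms mt st; rewrite (Ex_update s) -[RHS](Ex_cst n); apply: eq_Ex => p vp.
have s0 : (0 < s)%N by apply: leq_trans ms.
rewrite sum_attach_prob (maxn_idPr s0).
pose p0 := update p s ord0.
pose C := (mass p0 s)%:R * ((mass p0 t)%:R * b p t) * H p0.
have bt j : b (update p s j) t = b p t.
  by rewrite /b A_update // ffunE eq_sym (negbTE st).
rewrite (bigID (fun j : 'I_n.+1 => (j < m)%N)) /= [X in _ * (_ + X)]big1; last first.
  by move=> j /andP[_ /negbTE jm]; rewrite [b _ s]/b ffunE eqxx jm !mul0r mulr0 !mul0r.
rewrite (eq_big (fun j : 'I_n.+1 => j \in [set j : 'I_n.+1 | (j < m)%N])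
   (fun j => C * ((j \in A p)%:R - #|A p|%:R / m%:R))); last first.
- move=> j /andP[_ jm]; rewrite !mass_update // bt [b _ s]/b A_update // ffunE eqxx jm.
  rewrite /H total_mass_update // square_mass_update // -/(H p0) mul1r.
  by rewrite /C; ring.
- move=> j; rewrite inE; case jm: (j < m)%N; rewrite ?andbF // andbT.
  by apply: leq_trans ms; apply: leq_trans jm _.
(* Over the [m] possible parents below [m], the centred indicator sums to
   [#|A p| - m * (#|A p| / m) = 0]. *)
rewrite -big_distrr /= sumrB sumr_const card_ord_lt //.
rewrite -[_ *+ m]mulr_natr mulfVK ?pnatr_eq0 -?lt0n //.
rewrite (big_setID (A p)) /= [X in _ * (_ * (_ + X - _) + _)]big1; last first.
  by move=> j; rewrite inE => /andP[/negbTE->].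
have -> : [set j : 'I_n.+1 | (j < m)%N] :&: A p = A p.
  by apply/setIidPr/subsetP => j; rewrite !inE => /andP[].
rewrite (eq_bigr (fun=> 1)); last by move=> j ->.
by rewrite sumr_const !addr0 subrr !mulr0.
Qed.

Lemma deviation p : (mass_above p)%:R - #|A p|%:R / m%:R * (total_mass p)%:R =
  \sum_(t : 'I_n.+1 | (m <= t)%N) (mass p t)%:R * b p t.
Proof.
rewrite /mass_above /total_mass !natr_sum big_distrr /=.
rewrite big_mkcond [X in _ - X]big_mkcond [RHS]big_mkcond -sumrB.
apply: eq_bigr => t _; rewrite /b !inE.
case: (m <= t)%N; rewrite ?subrr //=; case: (p t < m)%N => /=; last by rewrite mul0r mulr0 subrr.
by case: (fconnect _ _ _); rewrite /=; ring.
Qed.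

(** Only the diagonal terms of the square survive. Each centred indicator is at most 1 in absolute
    value, so they add up to at most [square_mass p * H p <= tau]. *)
Lemma Ex_deviation :
  0 <= tau -> Ex (fun p => ((mass_above p)%:R - #|A p|%:R / m%:R * (total_mass p)%:R) ^+ 2 * H p)
  <= tau.
Proof.
move=> tau0.
have -> : Ex (fun p => ((mass_above p)%:R - #|A p|%:R / m%:R * (total_mass p)%:R) ^+ 2 * H p) =
    \sum_(s : 'I_n.+1 | (m <= s)%N) \sum_(t : 'I_n.+1 | (m <= t)%N)
    Ex (fun p => (mass p s)%:R * b p s * ((mass p t)%:R * b p t) * H p).
  under eq_bigr do rewrite -Ex_sum.
  rewrite -Ex_sum; apply: eq_Ex => p _; rewrite deviation expr2 big_distrl big_distrl /=.
  by apply: eq_bigr => s _; rewrite big_distrr big_distrl.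
rewrite (eq_bigr (fun s => Ex (fun p => (mass p s)%:R * b p s * ((mass p s)%:R * b p s) * H p))).
  rewrite -Ex_sum -[leRHS](Ex_cst n); apply: le_Ex => p vp.
  rewrite -big_distrl /=.
  apply: (@le_trans _ _ ((square_mass p)%:R * H p)).
    rewrite ler_wpM2r // natr_sum [leRHS]big_mkcondr; apply: ler_sum => s ms.
    rewrite /b; case: (p s < m)%N; last by rewrite mul0r !mulr0.
    rewrite mul1r natrX -expr2 exprMn ler_piMr ?sqr_ge0 //.
    have q0 : 0 <= #|A p|%:R / m%:R :> R by rewrite divr_ge0.
    have q1 : #|A p|%:R / m%:R <= 1 :> R.
      rewrite ler_pdivrMr ?ltr0n // mul1r ler_nat -[leqRHS](card_ord_lt m_le).
      by apply: subset_leq_card; apply/subsetP => j; rewrite !inE => /andP[].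
    move: (_ / _) q0 q1 => q q0 q1; case: (p s \in A p) => /=; nra.
  rewrite /H; case: ifP => [/andP[S0 VS]|_]; last by rewrite mulr0.
  by rewrite ler_pdivrMr // exprn_gt0 // ltr0n.
move=> s ms; rewrite (bigD1 s) //= big1 ?addr0 // => t /andP[mt ts].
by apply: cross_term; rewrite // eq_sym.
Qed.

(** A proportion of at least [2 * delta] in the initial tree against a share of mass below [delta]
    forces a deviation of at least [delta] times the total mass. *)
Lemma Pr_deviation (delta : R) : 0 <= tau -> 0 < delta ->
  Pr R (fun p => [&& (0 < total_mass p)%N,
     (square_mass p)%:R <= tau * (total_mass p)%:R ^+ 2,
     2 * delta * m%:R <= #|descendants p c m|%:R
   & (mass_above p)%:R < delta * (total_mass p)%:R]) <= tau / delta ^+ 2.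
Proof.
move=> tau0 d0.
apply: (@le_trans _ _ (Ex (fun p => ((mass_above p)%:R
    - #|A p|%:R / m%:R * (total_mass p)%:R) ^+ 2 * H p) / delta ^+ 2)); last first.
  by rewrite ler_wpM2r ?Ex_deviation // invr_ge0 exprn_ge0 // ltW.
apply: markov => [|p _|p vp /and4P[S0 VS Am low]]; first by rewrite exprn_gt0.
  by rewrite mulr_ge0 ?sqr_ge0.
rewrite /H S0 VS /= ler_pdivlMr ?exprn_gt0 ?ltr0n //.
rewrite -ler_pdivlMr ?ltr0n // in Am.
have S0' : 0 < (total_mass p)%:R :> R by rewrite ltr0n.
move: (_ / _) Am => q Am; rewrite -exprMn -[leRHS]sqrrN opprB.
rewrite ler_pXn2r ?nnegrE ?mulr_ge0 ?(ltW d0) //; last by rewrite subr_ge0; nra.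
by rewrite lerBrDr; nra.
Qed.

End Deviation.
End Chebyshev.

(** * A deterministic criterion *)

Section Success.
Context (R : realType) (n : nat) (kappa : R) (p : parents n).
Context (vp : admissible p).
Implicit Types (t v c x y : 'I_n.+1).

Local Notation hi := (high kappa p).
Local Notation X := (fun t => #|branch hi 0 p t|).

Lemma adj_forest alpha x y : kappa = (1 - alpha) * ln n.+1%:R ->
  adj (forest alpha (tree p)) x y =
  (x != y) && ((step hi 0 p x == y) || (step hi 0 p y == x)).
Proof.
move=> kE; rewrite /adj /= /forest_edges !inE.
have -> : [exists u in [set x; y], (deg (tree p) u)%:R <= (1 - alpha) * ln n.+1%:R] =
    ~~ (hi x && hi y).
  apply/existsP/idP => [[u]|].
    rewrite !inE => /andP[/orP[] /eqP->]; rewrite -kE leNgt => /negbTE; rewrite /high => ->//.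
    by rewrite andbF.
  rewrite negb_and /high -!leNgt => /orP[h|h]; [exists x|exists y];
    by rewrite !inE eqxx ?orbT /= -kE.
rewrite negbK.
have -> : ([set x; y] \in edges (tree p)) =
    ((p x < x)%N && (p x == y)) || ((p y < y)%N && (p y == x)).
  apply/imsetP/orP => [[i]|].
    rewrite inE => pi /setP e.
    have := e x; rewrite !inE eqxx /= => /esym/orP[]/eqP xi.
      have := e (p i); rewrite !inE eqxx orbT => /orP[]/eqP pix.
        by move: pi; rewrite pix xi ltnn.
      by left; rewrite xi pi pix eqxx.
    have := e i; rewrite !inE eqxx /= => /orP[]/eqP ix.
      by move: pi; rewrite -xi ix ltnn.
    by right; rewrite -ix pi -xi eqxx.
  case=> /andP[lt /eqP e]; first by exists x; rewrite ?inE // e.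
  by exists y; rewrite ?inE // e setUC.
(* One orientation of the adjacency, from child [u] to parent [w]; the other follows by exchanging
   the two. *)
have half u w : hi u && hi w && ((p u < u)%N && (p u == w)) =
    (u != w) && (step hi 0 p u == w).
  have [->|uw] := eqVneq u w => /=.
    have [->|] := eqVneq (p w) w; first by rewrite ltnn !andbF.
    by rewrite !andbF.
  have [pu|pu] := eqVneq (p u) w.
    rewrite andbT /step pu /= -pu.
    have -> : (p u < u)%N.
      apply: admissible_lt => //; rewrite lt0n; apply: contra_neqN uw => /eqP u0.
      have -> : u = ord0 by apply: val_inj.
      by rewrite -pu (_ : u = ord0) ?(admissible0 vp) //; exact: val_inj.
    rewrite andbT; case: ifP; first by rewrite eqxx.
    by rewrite pu (negbTE uw).
  rewrite !andbF; apply/esym/negbTE; rewrite /step; case: ifP => //.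
rewrite andb_orr half [hi x && hi y]andbC half (eq_sym y x).
by case: (x != y).
Qed.

(** Every cluster hanging from [t >= m] has size at most [B], less than half of [m1], while the root
    cluster has at least [m1 / 2] vertices; hence the total mass [S] is at least [m1 / 4 >= m]. Then
    [square_mass <= B * S <= tau * S ^ 2], so each child of the root among the first [L] vertices
    receives at least [2 * S / d], and the root cluster has at most [m + S <= 2 * S] vertices. *)
Lemma success alpha (m m1 m2 L k D s2 d : nat) (tau : R) :
  kappa = (1 - alpha) * ln n.+1%:R ->
  (0 < L <= m)%N -> (m <= n.+1)%N -> (0 < D)%N -> (0 < d)%N ->
  (2 * (k.+1 * D ^ k * s2.+1) < m1)%N -> (4 * m <= m1)%N ->
  (k.+1 * D ^ k * s2.+1)%:R <= tau * (m1%:R / 4) ->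
  (forall t, (t < m)%N -> hi t) ->
  (m1 <= 2 * X ord0)%N ->
  (forall v, indeg p v < D)%N ->
  ~~ [exists x, [forall i : 'I_k.+1, (m2 <= iter i p x)%N && hi (iter i p x)]] ->
  (forall t, (m <= t)%N -> (#|descendants p t m2| <= s2)%N) ->
  (2 < #|[set c : 'I_n.+1 | (0 < c < L)%N && (p c == ord0)]|)%N ->
  (forall c, (0 < c < L)%N -> (4 * m <= d * #|descendants p c m|)%N) ->
  (forall c, (0 < c < L)%N ->
    ~~ [&& (0 < total_mass kappa m p)%N,
        (square_mass kappa m p)%:R <= tau * (total_mass kappa m p)%:R ^+ 2,
        2 * (2 / d%:R) * m%:R <= #|descendants p c m|%:R :> R
      & (mass_above kappa m c p)%:R < (2 / d%:R) * (total_mass kappa m p)%:R :> R]) ->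
  ord0 \in root_set (d ^ 3) (forest alpha (tree p)).
Proof.
move=> kE /andP[L0 Lm] mn D0 d0; set B := (_ * _ ^ _ * _)%N => Bm1 mm1 Btau him X0m1 degD
  nochain small children desc dev.
have m0 : (0 < m)%N by apply: leq_trans Lm.
have XB t : (m <= t)%N -> (X t <= B)%N.
  move=> mt; apply: leq_trans (branch_card_le vp _ D0 degD nochain) _.
  by rewrite leq_mul2l ltnS small // orbT.
set S := total_mass kappa m p.
have X0S : (X ord0 <= m + S)%N := branch_root_le vp m0 him.
have S0 : (0 < S)%N by lia.
have m1S : (m1 <= 4 * S)%N by lia.
apply: (root_set_criterion vp (fun x y => adj_forest x y kE) m0 him).
  by move=> t mt; apply: leq_ltn_trans (XB t mt) _; lia.
apply: leq_trans children _; apply: subset_leq_card; apply/subsetP => c.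
rewrite !inE => /andP[cL /eqP pc]; case/andP: (cL) => c0 cL'.
rewrite c0 (leq_trans cL' Lm) pc eqxx /=.
have Xc : (mass_above kappa m c p <= X c)%N := branch_child_ge vp c him.
have tau0 : 0 <= tau.
  have : 0 <= tau * (m1%:R / 4) by apply: le_trans Btau.
  by rewrite pmulr_lge0 // divr_gt0 // ltr0n; lia.
have sq : (square_mass kappa m p)%:R <= tau * S%:R ^+ 2.
  apply: (@le_trans _ _ (B * S)%:R).
    rewrite ler_nat /square_mass big_distrr /=; apply: leq_sum => t /andP[mt _].
    rewrite expnS expn1 leq_mul2r; apply/orP; right; rewrite /mass.
    apply: leq_trans (XB t mt); rewrite -(branchE hi vp mt).
    by case: (hi t); rewrite ?mul1n.
  rewrite natrM expr2 mulrA ler_wpM2r //; apply: le_trans Btau _.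
  rewrite ler_wpM2l // ler_pdivrMr // -natrM ler_nat; lia.
have := dev c cL; rewrite S0 sq /= negb_and -leNgt -ltNge => /orP[|].
  have dP : 0 < d%:R :> R by rewrite ltr0n.
  rewrite ltNge; case/negP.
  rewrite (_ : 2 * (2 / d%:R) * m%:R = (4 * m)%:R / d%:R); last by rewrite natrM; ring.
  by rewrite ler_pdivrMr // -natrM ler_nat [X in (_ <= X)%N]mulnC desc.
have dP : 0 < d%:R :> R by rewrite ltr0n.
rewrite mulrAC ler_pdivrMr // -!natrM ler_nat => le2S.
by apply: leq_trans X0S _; apply: leq_trans (leq_mul (leqnn d) Xc); lia.
Qed.

End Success.

(** * Probabilities of the bad events *)

Section BadEvents.
Context (R : realType) (n : nat) (kappa : R).
Implicit Types (p : parents n) (t v c : 'I_n.+1).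

Lemma hits_le_deg p a v : (0 < a)%N -> admissible p ->
  (hits p [pred s : 'I_n.+1 | (a <= s < n.+1)%N] v <= deg (tree p) v)%N.
Proof.
move=> a0 vp; rewrite deg_tree //; apply: leq_trans (leq_addr _ _).
apply: subset_leq_card; apply/subsetP => s; rewrite !inE => /andP[/andP[as_ _] ->].
by rewrite andbT admissible_lt // (leq_trans a0).
Qed.

Lemma Pr_low a t (theta : R) : 0 <= theta -> (t < a <= n.+1)%N ->
  Pr R (fun p => ~~ high kappa p t) <=
  expR (theta * kappa - theta / (1 + theta) * ln (n.+1%:R / a%:R)).
Proof.
move=> th0 /andP[ta an].
apply: le_trans (lower_tail kappa th0 ta _); last by rewrite an /=.
apply: Pr_sub => p vp; rewrite /high -leNgt; apply: le_trans.
by rewrite ler_nat hits_le_deg // (leq_ltn_trans _ ta).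
Qed.

Lemma Pr_exists_low m (theta : R) : 0 <= theta -> (m <= n.+1)%N ->
  Pr R (fun p => [exists t : 'I_n.+1, (t < m)%N && ~~ high kappa p t]) <=
  m%:R * expR (theta * kappa - theta / (1 + theta) * ln (n.+1%:R / m%:R)).
Proof.
move=> th0 mn; apply: le_trans (Pr_exists _ _ _) _.
apply: (@le_trans _ _ (\sum_(t : 'I_n.+1 | (t < m)%N)
  expR (theta * kappa - theta / (1 + theta) * ln (n.+1%:R / m%:R)))).
  by apply: ler_sum => t tm; apply: Pr_low => //; rewrite tm.
rewrite sumr_const -[leLHS]mulr_natl ler_wpM2r ?expR_ge0 // ler_nat.
rewrite -[leqRHS](card_ord_lt mn); apply: subset_leq_card.
by apply/subsetP => t; rewrite !inE.
Qed.

(** The subtree at time [m] uses the coordinates below [m], and the degree is bounded below by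
    children from [m] on: the two factors are independent. *)
Lemma Ex_desc_low m t (theta : R) : 0 <= theta -> (t < m <= n.+1)%N ->
  Ex (fun p => #|descendants p t m|%:R * (~~ high kappa p t)%:R) <=
  expR (theta * kappa - theta / (1 + theta) * ln (n.+1%:R / m%:R)) *
  (m%:R / t.+1%:R).
Proof.
move=> th0 tmn; case/andP: (tmn) => tm mn.
pose S := [pred s : 'I_n.+1 | (m <= s < n.+1)%N].
apply: (@le_trans _ _ (Ex (fun p => #|descendants p t m|%:R *
    (((hits p S t)%:R <= kappa)%R)%:R))).
  apply: le_Ex => p vp; rewrite ler_wpM2l // ler_nat /high -leNgt.
  case: leP => // degk; rewrite (_ : _ <= kappa) //; apply: le_trans degk.
  by rewrite ler_nat hits_le_deg // (leq_ltn_trans _ tm).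
rewrite (@Ex_indep R n [pred s : 'I_n.+1 | (s < m)%N]).
- rewrite Ex_descendants // mulrC ler_wpM2r ?divr_ge0 //.
  by apply: lower_tail; rewrite ?mn /=.
- by move=> p q vp vq pq; rewrite (descendants_local t vp pq).
- move=> p q vp vq pq; congr ((_%:R <= _)%R%:R); apply: eq_card => s; rewrite !inE.
  by case ms: (m <= s)%N => //=; rewrite pq // inE /= -leqNgt.
Qed.

(** A vertex below [m] outside the root cluster has a low ancestor, possibly itself, and is counted
    among the descendants of that ancestor. *)
Lemma card_root_branch p m : admissible p -> (m <= n.+1)%N ->
  (m <= #|branch (high kappa p) 0 p ord0| +
   \sum_(t : 'I_n.+1 | (t < m)%N) #|descendants p t m| * ~~ high kappa p t)%N.
Proof.
move=> vp mn; set hi := high kappa p.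
have sub : [set x : 'I_n.+1 | (x < m)%N] \subset branch hi 0 p ord0 :|:
    \bigcup_(t : 'I_n.+1 | (t < m)%N && ~~ hi t) descendants p t m.
  apply/subsetP => x; rewrite !inE => xm.
  have [//|x0 /=] := boolP (fconnect _ x ord0); apply/bigcupP.
  have [r xr fr] := fixpoint_exists hi 0 x vp.
  have pxr := step_fconnect xr.
  have low : ~~ (hi r && hi (p r)).
    apply: contra x0 => /andP[h1 h2]; suff <- : r = ord0 by [].
    apply: val_inj; apply/eqP; rewrite /= -leqn0 leqNgt; apply/negP => r0.
    by have := admissible_lt vp r0; rewrite -{2}fr /step h1 h2 ltnn.
  have anc y : fconnect p x y -> ~~ hi y -> exists2 t : 'I_n.+1,
      (t < m)%N && ~~ hi t & x \in descendants p t m.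
    move=> xy hy; exists y; last by rewrite inE xm.
    by rewrite hy andbT; apply: leq_ltn_trans xm; exact: descendant_ge xy.
  move: low; rewrite negb_and => /orP[|]; apply: anc => //.
  exact: connect_trans pxr (fconnect1 _ _).
rewrite -[leqLHS](card_ord_lt mn); apply: leq_trans (subset_leq_card sub) _.
apply: leq_trans (leq_card_setU _ _) _; rewrite leq_add2l.
apply: leq_trans (leq_card_bigcup _ _) _; rewrite big_mkcondr.
by apply: leq_sum => t _; case: (hi t); rewrite ?muln1.
Qed.

(** Markov's inequality for the number of vertices lost below low ancestors; the means [m / t.+1]
    sum to at most [m * (2 + ln n.+1)]. *)
Lemma Pr_small_root_branch m (theta : R) : 0 <= theta -> (0 < m <= n.+1)%N ->
  Pr R (fun p => (2 * #|branch (high kappa p) 0 p ord0| < m)%N) <=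
  2 * (2 + ln n.+1%:R) *
  expR (theta * kappa - theta / (1 + theta) * ln (n.+1%:R / m%:R)).
Proof.
move=> th0 /andP[m0 mn].
pose f p := \sum_(t : 'I_n.+1 | (t < m)%N)
  (#|descendants p t m|%:R * (~~ high kappa p t)%:R : R).
apply: (@le_trans _ _ (Ex f / (m%:R / 2))).
  apply: markov => [|p _|p vp small]; first by rewrite divr_gt0 // ltr0n.
    by apply: sumr_ge0 => t _; rewrite mulr_ge0.
  rewrite ler_pdivrMr // /f; under eq_bigr do rewrite -natrM.
  rewrite -natr_sum -natrM ler_nat.
  move: (card_root_branch vp mn) small; set b := #|pred_of_set (branch _ _ _ _)|.
  set s := (\sum_(i < n.+1 | _) _)%N; lia.
rewrite invf_div mulrA ler_pdivrMr ?ltr0n // /f Ex_sum; set e := expR _.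
apply: (@le_trans _ _ ((\sum_(t : 'I_n.+1 | (t < m)%N) e * (m%:R / t.+1%:R)) * 2)).
  by rewrite ler_wpM2r //; apply: ler_sum => t tm; apply: Ex_desc_low; rewrite ?tm.
rewrite -big_distrr -big_distrr /=.
rewrite [leRHS](_ : _ = e * (m%:R * (2 + ln n.+1%:R)) * 2); last by ring.
rewrite ler_wpM2r // ler_wpM2l ?expR_ge0 // ler_wpM2l //.
apply: le_trans (sum_inv_max_le R n); rewrite [leLHS]big_mkcond; apply: ler_sum => t _.
case: ifP => _; last by rewrite invr_ge0.
by rewrite lef_pV2 ?posrE ?ltr0n // ?ler_nat ?leq_max // geq_max /=.
Qed.

Lemma Pr_large_indeg D :
  Pr R (fun p => [exists v, (D <= indeg p v)%N]) <=
  n.+1%:R * expR (1 + ln n.+1%:R - D%:R / 2).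
Proof.
apply: le_trans (@Pr_exists R n _ predT (fun v p => (D <= indeg p v)%N)) _.
apply: (@le_trans _ _ (\sum_(v < n.+1) expR (1 + ln n.+1%:R - D%:R / 2))).
  apply: ler_sum => v _; apply: le_trans (upper_tail v D%:R).
  by apply: Pr_sub => p _; rewrite ler_nat.
by rewrite sumr_const card_ord [leRHS]mulr_natl.
Qed.

(** Second moment bound for each [t]; the resulting factors [1 / ((t + 1) (t + 2))] telescope to at
    most [1 / (m + 1)]. *)
Lemma Pr_large_descendants m m2 s2 : (0 < m <= n.+1)%N -> (m2 <= n.+1)%N -> (0 < s2)%N ->
  Pr R (fun p => [exists t : 'I_n.+1, (m <= t)%N && (s2 < #|descendants p t m2|)%N]) <=
  2 * (m2%:R * m2.+1%:R) / (m%:R * s2%:R ^+ 2).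
Proof.
move=> /andP[m0 mn1] mn s0; apply: le_trans (Pr_exists _ _ _) _.
set C := _ / _.
apply: (@le_trans _ _ (\sum_(t : 'I_n.+1 | (m <= t)%N) (C * m%:R) * (t.+1%:R * t.+2%:R)^-1)).
  apply: ler_sum => t mt.
  have rhs0 : 0 <= C * m%:R / (t.+1%:R * t.+2%:R).
    by rewrite !mulr_ge0 ?invr_ge0 ?mulr_ge0 ?exprn_ge0.
  have [m2t|tm2] := leqP m2 t.
    apply: le_trans rhs0; rewrite -[leRHS](Ex_cst n); apply: le_Ex => p vp.
    rewrite (_ : descendants p t m2 = set0) ?cards0 //; apply/setP => x; rewrite !inE.
    apply/negP => /andP[xm2 /(descendant_ge vp) tx].
    by move: xm2; rewrite ltnNge (leq_trans m2t tx).
  apply: (@le_trans _ _ (Ex (fun p => #|descendants p t m2|%:R *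
      #|descendants p t m2|.+1%:R) / s2%:R ^+ 2)).
    apply: markov => [|p _|p vp big]; first by rewrite exprn_gt0 // ltr0n.
      by rewrite mulr_ge0.
    by rewrite expr2 -!natrM ler_nat leq_mul // ltnW // ltnW.
  rewrite Ex_descendants2 ?tm2 // /C le_eqVlt; apply/orP; left; apply/eqP; field.
  by rewrite -natrD nat1r !pnatr_eq0; lia.
rewrite -big_distrr /= -mulrA ler_piMr //.
  by rewrite /C !mulr_ge0 ?invr_ge0 ?mulr_ge0 ?exprn_ge0.
rewrite (eq_bigr (fun t : 'I_n.+1 => - t.+2%:R^-1 - - t.+1%:R^-1)); last first.
  move=> t _; rewrite -[t.+2%:R]natr1; have : 0 < t.+1%:R :> R by [].
  by move: t.+1%:R => a a0; field; rewrite !gt_eqF ?addr_gt0.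
rewrite -(big_mkord (fun t : nat => m <= t)%N (fun t : nat => - t.+2%:R^-1 - - t.+1%:R^-1)).
rewrite [X in _ * X](_ : _ = \sum_(m <= t < n.+1) (- t.+2%:R^-1 - - t.+1%:R^-1)); last first.
  by rewrite [RHS](@big_nat_widenl _ _ _ m 0).
rewrite (telescope_sumr (fun t : nat => - t.+1%:R^-1)) //.
have n2 : 0 <= n.+2%:R^-1 :> R by rewrite invr_ge0.
apply: (@le_trans _ _ (m%:R / m.+1%:R)); first by rewrite ler_wpM2l // opprK gerDr oppr_le0.
by rewrite ler_pdivrMr // mul1r ler_nat.
Qed.

(** Lower tail with [theta = 1] and [kappa = 2]; starting at [a = 1] leaves out the loop at the
    root. *)
Lemma Pr_few_children L : (0 < L <= n.+1)%N ->
  Pr R (fun p => (#|[set c : 'I_n.+1 | (0 < c < L)%N && (p c == ord0)]| <= 2)%N) <=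
  expR (2 - 2^-1 * ln L%:R).
Proof.
move=> /andP[L0 Ln].
have := @lower_tail R n 1 L ord0 1 2 _ _ _.
rewrite !mul1r divr1 (_ : 1 + 1 = 2) // => /(_ ler01 isT) le.
apply: le_trans (le _); last by rewrite L0.
by apply: Pr_sub => p _; rewrite ler_nat.
Qed.

Lemma Pr_few_descendants m L d : (0 < d)%N -> (1 < m <= n.+1)%N -> (L <= m)%N ->
  Pr R (fun p => [exists c : 'I_n.+1, (0 < c < L)%N
                    && (d * #|descendants p c m| < 4 * m)%N]) <=
  L%:R * ((4 * m %/ d).+1%:R * (L%:R / m.-1%:R)).
Proof.
move=> d0 /andP[m1 mn] Lm; apply: le_trans (Pr_exists _ _ _) _.
apply: (@le_trans _ _ (\sum_(c : 'I_n.+1 | (0 < c < L)%N)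
   ((4 * m %/ d).+1%:R * (L%:R / m.-1%:R)))).
  apply: ler_sum => c /andP[c0 cL].
  apply: (@le_trans _ _ (Pr R (fun p => (#|descendants p c m| <= 4 * m %/ d)%N))).
    by apply: Pr_sub => p _ /ltnW; rewrite mulnC leq_divRL.
  apply: le_trans (Pr_descendants_le _ _ c0 _) _.
    by rewrite (leq_trans cL Lm).
  rewrite ler_wpM2l // ler_wpM2r ?invr_ge0 //; by rewrite ler_nat ltnW.
rewrite sumr_const -[leLHS]mulr_natl ler_wpM2r ?mulr_ge0 ?invr_ge0 // ler_nat.
rewrite -[leqRHS](card_ord_lt (leq_trans Lm mn)); apply: subset_leq_card.
by apply/subsetP => c; rewrite !inE => /andP[].
Qed.

Lemma Pr_exists_deviation m L (tau delta : R) : (L <= m <= n.+1)%N ->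
  0 <= tau -> 0 < delta ->
  Pr R (fun p => [exists c : 'I_n.+1, (0 < c < L)%N
    && [&& (0 < total_mass kappa m p)%N,
        (square_mass kappa m p)%:R <= tau * (total_mass kappa m p)%:R ^+ 2,
        2 * delta * m%:R <= #|descendants p c m|%:R :> R
      & (mass_above kappa m c p)%:R < delta * (total_mass kappa m p)%:R :> R]]) <=
  L%:R * (tau / delta ^+ 2).
Proof.
move=> /andP[Lm mn] tau0 d0; apply: le_trans (Pr_exists _ _ _) _.
apply: (@le_trans _ _ (\sum_(c : 'I_n.+1 | (0 < c < L)%N) (tau / delta ^+ 2))).
  apply: ler_sum => c /andP[_ cL]; apply: Pr_deviation => //.
  by apply: leq_trans Lm.
rewrite sumr_const -[leLHS]mulr_natl ler_wpM2r ?divr_ge0 ?exprn_ge0 ?(ltW d0) //.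
rewrite ler_nat -[leqRHS](card_ord_lt (leq_trans Lm mn)); apply: subset_leq_card.
by apply/subsetP => c; rewrite !inE => /andP[].
Qed.

End BadEvents.

(** * Union bound and explicit thresholds *)

Section Failure.
Context (R : realType).

(** The eight terms bound, in this order: a low early vertex, a small root cluster, a large
    in-degree, a long chain of high vertices, a large late subtree, few early children of the root,
    a small subtree of an early vertex, and an atypical share of mass. *)
Lemma failure_bound n (alpha kappa tau theta1 theta2 theta3 : R)
    (m m1 m2 L k D s2 d : nat) :
  kappa = (1 - alpha) * ln n.+1%:R ->
  0 <= theta1 -> 0 <= theta2 -> 0 <= theta3 -> 0 <= tau ->
  (0 < L <= m)%N -> (1 < m)%N -> (m1 <= n.+1)%N -> (0 < m2 <= n.+1)%N -> (0 < D)%N ->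
  (0 < s2)%N -> (0 < d)%N ->
  (2 * (k.+1 * D ^ k * s2.+1) < m1)%N -> (4 * m <= m1)%N ->
  (k.+1 * D ^ k * s2.+1)%:R <= tau * (m1%:R / 4) ->
  Pr R (fun p : parents n => ord0 \notin root_set (d ^ 3) (forest alpha (tree p))) <=
  m%:R * expR (theta1 * kappa - theta1 / (1 + theta1) * ln (n.+1%:R / m%:R))
  + 2 * (2 + ln n.+1%:R) *
    expR (theta2 * kappa - theta2 / (1 + theta2) * ln (n.+1%:R / m1%:R))
  + n.+1%:R * expR (1 + ln n.+1%:R - D%:R / 2)
  + n.+1%:R * (2 + ln n.+1%:R) ^+ k * expR (k.+1%:R * (2 * theta3 - theta3 * kappa
        + (expR theta3 - 1) * ln (n.+1%:R / m2%:R)))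
  + 2 * (m2%:R * m2.+1%:R) / (m%:R * s2%:R ^+ 2)
  + expR (2 - 2^-1 * ln L%:R)
  + L%:R * ((4 * m %/ d).+1%:R * (L%:R / m.-1%:R))
  + L%:R * (tau / (2 / d%:R) ^+ 2).
Proof.
move=> kE th1 th2 th3 tau0 /andP[L0 Lm] m_1 m1n /andP[m20 m2n] D0 s0 d0 Bm1 mm1 Btau.
have mn : (m <= n.+1)%N by lia.
have m0 : (0 < m)%N by lia.
pose hi := @high R n kappa.
pose b1 (p : parents n) := [exists t : 'I_n.+1, (t < m)%N && ~~ hi p t].
pose b2 (p : parents n) := (2 * #|branch (hi p) 0 p ord0| < m1)%N.
pose b3 (p : parents n) := [exists v : 'I_n.+1, (D <= indeg p v)%N].
pose b4 (p : parents n) := [exists x, [forall i : 'I_k.+1,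
      (m2 <= iter i p x)%N && (kappa < (deg (tree p) (iter i p x))%:R)]].
pose b5 (p : parents n) := [exists t : 'I_n.+1, (m <= t)%N && (s2 < #|descendants p t m2|)%N].
pose b6 (p : parents n) := (#|[set c : 'I_n.+1 | (0 < c < L)%N && (p c == ord0)]| <= 2)%N.
pose b7 (p : parents n) :=
  [exists c : 'I_n.+1, (0 < c < L)%N && (d * #|descendants p c m| < 4 * m)%N].
pose b8 (p : parents n) := [exists c : 'I_n.+1, (0 < c < L)%N && [&& (0 < total_mass kappa m p)%N,
        (square_mass kappa m p)%:R <= tau * (total_mass kappa m p)%:R ^+ 2,
        2 * (2 / d%:R) * m%:R <= #|descendants p c m|%:R :> R
      & (mass_above kappa m c p)%:R < (2 / d%:R) * (total_mass kappa m p)%:R :> R]].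
apply: (@le_trans _ _ (Pr R (fun p => b1 p || b2 p || b3 p || b4 p || b5 p || b6 p
  || b7 p || b8 p))).
  apply: Pr_sub => p vp; apply: contraR; rewrite !negb_or.
  case/andP=> /andP[/andP[/andP[/andP[/andP[/andP[n1 n2] n3] n4] n5] n6] n7] n8.
  apply: (@success R n kappa p vp alpha m m1 m2 L k D s2 d tau) => //.
  - by rewrite L0.
  - by move=> t tm; move/existsPn/(_ t): n1; rewrite tm negbK.
  - by rewrite leqNgt.
  - by move=> v; move/existsPn/(_ v): n3; rewrite -ltnNge.
  - by move=> t mt; move/existsPn/(_ t): n5; rewrite mt -leqNgt.
  - by rewrite ltnNge.
  - by move=> c cL; move/existsPn/(_ c): n7; rewrite cL -leqNgt.
  - by move=> c cL; move/existsPn/(_ c): n8; rewrite cL.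
do 7?apply: PrU_le.
- exact: Pr_exists_low.
- by apply: Pr_small_root_branch; rewrite // m1n andbT; lia.
- exact: Pr_large_indeg.
- exact: chain_bound.
- by apply: Pr_large_descendants; rewrite // m0.
- by apply: Pr_few_children; rewrite L0 (leq_trans Lm).
- by apply: Pr_few_descendants; rewrite // m_1.
- by apply: Pr_exists_deviation; rewrite ?Lm ?divr_gt0 ?ltr0n.
Qed.

(** The variable stands for [ln n.+1]. *)
Definition for_large (P : R -> Prop) := exists T0, forall T, T0 <= T -> P T.

Lemma for_large_and (P Q : R -> Prop) : for_large P -> for_large Q ->
  for_large (fun T => P T /\ Q T).
Proof.
move=> [T1 h1] [T2 h2]; exists (Num.max T1 T2) => T; rewrite ge_max => /andP[le1 le2].
by split; [exact: h1 | exact: h2].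
Qed.

Lemma for_large_ge T0 : for_large (fun T => T0 <= T).
Proof. by exists T0. Qed.

(** The Taylor term of order [k + 1] of [exp (x (2 + T))] dominates the power [k]. The factor
    [expR (2 * x)] in [K] pays for replacing [T] by [2 + T]. *)
Lemma for_large_decay (C : R) k x e : 0 < x -> 0 < e ->
  for_large (fun T => C * (2 + T) ^+ k * expR (- (x * T)) <= e).
Proof.
move=> x0 e0; pose K := `|C| * expR (2 * x) * (k.+1)`!%:R / x ^+ k.
have K0 : 0 <= K by rewrite !mulr_ge0 ?invr_ge0 ?exprn_ge0 ?expR_ge0 ?(ltW x0).
exists (K / (x * e)) => T leT.
have T0 : 0 <= T by apply: le_trans leT; rewrite divr_ge0 // mulr_ge0 // ltW.
have T2 : 0 < 2 + T by lra.
have xT : 0 < x * (2 + T) by rewrite mulr_gt0.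
have pow : (x * (2 + T)) ^+ k.+1 / (k.+1)`!%:R <= expR (x * (2 + T)).
  by apply: le_trans (expR_ge1Dxn k (ltW xT)); rewrite lerDr ler01.
rewrite -(ler_pM2r (expR_gt0 (x * (2 + T)))) -[_ * expR (- _) * _]mulrA -expRD.
have -> : - (x * T) + x * (2 + T) = 2 * x by ring.
apply: (@le_trans _ _ (e * ((x * (2 + T)) ^+ k.+1 / (k.+1)`!%:R))); last first.
  by rewrite ler_wpM2l // ltW.
have f0 : 0 < (k.+1)`!%:R :> R by rewrite ltr0n fact_gt0.
rewrite mulrA ler_pdivlMr //.
apply: (@le_trans _ _ (K * (x * (2 + T)) ^+ k)).
  rewrite exprMn /K [leRHS](_ : _ = `|C| * ((2 + T) ^+ k * expR (2 * x) * (k.+1)`!%:R)).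
    rewrite -!mulrA ler_wpM2r ?ler_norm // !mulr_ge0 ?exprn_ge0 ?expR_ge0 //; lra.
  by field; rewrite expf_neq0 // gt_eqF.
rewrite exprS mulrA ler_wpM2r ?exprn_ge0 ?(ltW xT) //.
rewrite (_ : e * (x * (2 + T)) = x * e * (2 + T)); last by ring.
have : K <= T * (x * e) by rewrite -ler_pdivrMr // mulr_gt0.
have : 0 < x * e by rewrite mulr_gt0.
move: (x * e) => xe xe0 KT; nra.
Qed.

End Failure.

(** * Asymptotics *)

Section Asymptotics.
Context (R : realType).
Implicit Types (a x T alpha theta : R).

Definition up x : nat := (Num.truncn (expR x)).+1.

Lemma up_gt x : expR x < (up x)%:R.
Proof. exact: truncnS_gt. Qed.

Lemma up_le x : 0 <= x -> (up x)%:R <= 2 * expR x.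
Proof.
move=> x0; have := truncn_itv (expR_ge0 x) => /andP[le _].
have : 1 <= expR x by rewrite -[leLHS]expR0 ler_expR.
by rewrite /up -natr1; move: (_%:R) le => y; lra.
Qed.

(** With [a = alpha - 2 * theta], the coefficient of [ln N] is
    [- theta ^ 2 (1 + alpha) / (1 + theta)], at most [- theta ^ 2 / 2]. The constant 1 absorbs the
    factor 2 in the bound on [m]. *)
Lemma low_exponent (N m : nat) a alpha theta : (0 < N)%N -> (0 < m)%N ->
  m%:R <= 2 * expR (a * ln N%:R) -> 0 < theta -> theta <= 1 -> 0 <= alpha ->
  alpha - a = 2 * theta -> 0 <= ln N%:R :> R ->
  theta * ((1 - alpha) * ln N%:R) - theta / (1 + theta) * ln (N%:R / m%:R) <=
  1 - theta ^+ 2 / 2 * ln N%:R.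
Proof.
move=> N0 m0 mle th0 th1 al0 ath T0; have mP : 0 < m%:R :> R by rewrite ltr0n.
have NP : 0 < N%:R :> R by rewrite ltr0n.
rewrite ln_div ?posrE //; set T := ln N%:R in mle T0 *.
have lnm : ln m%:R <= 1 + a * T.
  have : ln m%:R <= ln (2 * expR (a * T)) by rewrite ler_ln ?posrE ?mulr_gt0 ?expR_gt0.
  rewrite lnM ?posrE ?expR_gt0 // expRK => h; apply: le_trans h _.
  by rewrite lerD2r (_ : 2 = 1 + 1) //; apply: le_ln1Dx; lra.
move: (ln _) lnm => y lnm.
have P1 : 0 < 1 + theta by lra.
rewrite mulrAC -(ler_pM2r P1) mulrBl divfK ?gt_eqF //.
have aT : y <= 1 + (alpha - 2 * theta) * T by have -> : alpha - 2 * theta = a by lra.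
have h1 : theta * y <= theta * (1 + (alpha - 2 * theta) * T) by rewrite ler_wpM2l // ltW.
have h2 : 0 <= theta ^+ 2 * T by rewrite mulr_ge0 ?sqr_ge0.
have h3 : 0 <= theta ^+ 2 * T * alpha by rewrite mulr_ge0.
have h4 : 0 <= theta ^+ 2 * T * (1 - theta) by rewrite mulr_ge0 //; lra.
rewrite !expr2 in h2 h3 h4 *; nra.
Qed.

(** By [exp theta - 1 <= theta / (1 - theta)], the coefficient of [ln N] is at most
    [- theta ^ 2 (1 + alpha) / (1 - theta)], hence at most [- theta ^ 2]. *)
Lemma chain_exponent (N m : nat) alpha theta : (0 < N)%N ->
  expR ((alpha + 2 * theta) * ln N%:R) <= m%:R -> 0 < theta -> theta <= 2^-1 ->
  0 <= alpha -> alpha + 2 * theta <= 1 -> 0 <= ln N%:R :> R ->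
  2 * theta - theta * ((1 - alpha) * ln N%:R) + (expR theta - 1) * ln (N%:R / m%:R) <=
  1 - theta ^+ 2 * ln N%:R.
Proof.
move=> N0 lem th0 th1 al0 al1 T0.
have NP : 0 < N%:R :> R by rewrite ltr0n.
have mP : 0 < m%:R :> R by apply: lt_le_trans lem; exact: expR_gt0.
rewrite ln_div ?posrE //; set T := ln N%:R in lem T0 *.
have lnm : (alpha + 2 * theta) * T <= ln m%:R by rewrite -ler_expR lnK ?posrE.
have P1 : 0 < 1 - theta by lra.
have e0 : 0 <= expR theta - 1 by rewrite subr_ge0 -[leLHS]expR0 ler_expR ltW.
have e1 : (expR theta - 1) * (1 - theta) <= theta.
  by rewrite -ler_pdivlMr //; apply: expR_le_geom; lra.
move: (expR theta - 1) e0 e1 => e e0 e1; move: (ln _) lnm => y lnm.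
have h1 : e * (T - y) <= e * ((1 - alpha - 2 * theta) * T) by rewrite ler_wpM2l //; lra.
have B0 : 0 <= (1 - alpha - 2 * theta) * T by rewrite mulr_ge0 //; lra.
have h2 : e * (1 - theta) * ((1 - alpha - 2 * theta) * T) <=
          theta * ((1 - alpha - 2 * theta) * T) by rewrite ler_wpM2r.
have h3 : 0 <= theta ^+ 2 * T by rewrite mulr_ge0 ?sqr_ge0.
have h4 : 0 <= theta ^+ 2 * T * alpha by rewrite mulr_ge0.
have h5 : 0 <= theta ^+ 2 * T * theta by rewrite mulr_ge0 // ltW.
apply: (@le_trans _ _ (2 * theta - theta * ((1 - alpha) * T)
   + e * ((1 - alpha - 2 * theta) * T))); first by lra.
rewrite -(ler_pM2r P1) !expr2 in h3 h4 h5 *.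
have h6 : 2 * theta * (1 - theta) <= 1 - theta by rewrite ler_piMl //; lra.
nra.
Qed.

End Asymptotics.

(** * Decay of the individual terms *)

Section Terms.
Context (R : realType).
Implicit Types (a c x y u v T alpha theta : R).

Lemma decay_shift u v x y T : u * expR (- (x * T)) <= v ->
  u * expR ((y - x) * T) <= v * expR (y * T).
Proof.
move=> le; rewrite (_ : (y - x) * T = - (x * T) + y * T); last by ring.
by rewrite expRD mulrA ler_wpM2r ?expR_ge0.
Qed.

Lemma term_low (N m : nat) c alpha theta v : (0 < N)%N -> (0 < m)%N ->
  m%:R <= 2 * expR (c * ln N%:R) -> 0 < theta -> theta <= 1 -> 0 <= alpha ->
  alpha - c = 2 * theta -> 0 <= ln N%:R :> R ->
  2 * expR 1 * expR (- ((theta ^+ 2 / 2 - c) * ln N%:R)) <= v ->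
  m%:R * expR (theta * ((1 - alpha) * ln N%:R) -
    theta / (1 + theta) * ln (N%:R / m%:R)) <= v.
Proof.
move=> N0 m0 mU th0 th1 al0 E T0; apply: le_trans.
have low := low_exponent N0 m0 mU th0 th1 al0 E T0.
apply: (@le_trans _ _ (2 * expR (c * ln N%:R) * expR (1 - theta ^+ 2 / 2 * ln N%:R))).
  by rewrite ler_pM ?expR_ge0 // ler_expR.
rewrite -[leLHS]mulrA -[leRHS]mulrA -!expRD ler_wpM2l // ler_expR.
by rewrite le_eqVlt; apply/orP; left; apply/eqP; ring.
Qed.

Lemma term_lost (N m : nat) alpha theta v : (0 < N)%N -> (0 < m)%N ->
  m%:R <= 2 * expR ((alpha - 2 * theta) * ln N%:R) -> 0 < theta -> theta <= 1 ->
  0 <= alpha -> 0 <= ln N%:R :> R ->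
  2 * expR 1 * (2 + ln N%:R) * expR (- (theta ^+ 2 / 2 * ln N%:R)) <= v ->
  2 * (2 + ln N%:R) * expR (theta * ((1 - alpha) * ln N%:R) -
    theta / (1 + theta) * ln (N%:R / m%:R)) <= v.
Proof.
move=> N0 m0 mU th0 th1 al0 T0; apply: le_trans.
have E : alpha - (alpha - 2 * theta) = 2 * theta by ring.
have low := low_exponent N0 m0 mU th0 th1 al0 E T0.
apply: (@le_trans _ _ (2 * (2 + ln N%:R) * expR (1 - theta ^+ 2 / 2 * ln N%:R))).
  by rewrite ler_wpM2l ?ler_expR // mulr_ge0 // addr_ge0.
by rewrite expRD le_eqVlt; apply/orP; left; apply/eqP; ring.
Qed.

Lemma term_indeg (N D : nat) v : (0 < N)%N -> 6 * ln N%:R <= D%:R :> R ->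
  expR 1 * expR (- (1 * ln N%:R)) <= v ->
  N%:R * expR (1 + ln N%:R - D%:R / 2) <= v.
Proof.
move=> N0 DL; apply: le_trans.
rewrite -[X in X * _ <= _]lnK ?posrE ?ltr0n // -!expRD ler_expR.
by move: (ln _) DL => T; lra.
Qed.

(** A chain with [k.+1 * theta ^ 2 >= 2] gains [N ^ (-2)], enough to beat the factor [N] of the
    union bound. *)
Lemma term_chain (N m k : nat) alpha theta v : (0 < N)%N ->
  expR ((alpha + 2 * theta) * ln N%:R) <= m%:R -> 0 < theta -> theta <= 2^-1 ->
  0 <= alpha -> alpha + 2 * theta <= 1 -> 0 <= ln N%:R :> R ->
  2 <= k.+1%:R * theta ^+ 2 ->
  expR k.+1%:R * (2 + ln N%:R) ^+ k * expR (- (1 * ln N%:R)) <= v ->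
  N%:R * (2 + ln N%:R) ^+ k * expR (k.+1%:R *
    (2 * theta - theta * ((1 - alpha) * ln N%:R)
     + (expR theta - 1) * ln (N%:R / m%:R))) <= v.
Proof.
move=> N0 mL th0 th1 al0 al1 T0 k2; apply: le_trans.
have low := chain_exponent N0 mL th0 th1 al0 al1 T0.
have pow : 0 <= (2 + ln N%:R) ^+ k :> R by rewrite exprn_ge0 // addr_ge0.
apply: (@le_trans _ _ (N%:R * (2 + ln N%:R) ^+ k *
    expR (k.+1%:R * (1 - theta ^+ 2 * ln N%:R)))).
  by rewrite ler_wpM2l ?mulr_ge0 // ler_expR ler_wpM2l.
rewrite -[X in X * _ * _ <= _]lnK ?posrE ?ltr0n //.
rewrite mulrAC -expRD [leRHS]mulrAC -expRD ler_wpM2r // ler_expR.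
move: (ln _) T0 {pow low mL} => T T0; move: (theta ^+ 2) k2 => z k2.
have := ler_wpM2r T0 k2; move: (k.+1%:R) => K; lra.
Qed.

(** The exponents balance as [2 a - c - 2 x = - c / 2]; the constant 12 is [2 * 2 * 3], from
    rounding up [m2] and [m2.+1]. *)
Lemma term_descendants (m m2 s2 : nat) a c x T v : (0 < m)%N -> (0 < s2)%N ->
  expR (c * T) <= m%:R -> m2%:R <= 2 * expR (a * T) -> expR (x * T) <= s2%:R ->
  x = a - c / 4 -> 0 <= a * T ->
  12 * expR (- (c / 2 * T)) <= v ->
  2 * (m2%:R * m2.+1%:R) / (m%:R * s2%:R ^+ 2) <= v.
Proof.
move=> m0 s0 mL m2U s2L xE aT; apply: le_trans.
rewrite ler_pdivrMr ?mulr_gt0 ?exprn_gt0 ?ltr0n //.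
apply: (@le_trans _ _ (12 * expR (- (c / 2 * T)) * (expR (c * T) * expR (x * T) ^+ 2))); last first.
  rewrite ler_wpM2l ?mulr_ge0 ?expR_ge0 // ler_pM ?expR_ge0 ?exprn_ge0 ?expR_ge0 //.
  by rewrite lerXn2r ?nnegrE ?expR_ge0.
have -> : 12 * expR (- (c / 2 * T)) * (expR (c * T) * expR (x * T) ^+ 2) =
   2 * (2 * expR (a * T) * (3 * expR (a * T))).
  rewrite expr2 -mulrA -!expRD [RHS](_ : _ = 12 * (expR (a * T) * expR (a * T))); last by ring.
  by rewrite -expRD; congr (_ * expR _); rewrite xE; field.
rewrite ler_wpM2l // ler_pM // -natr1.
have : 1 <= expR (a * T) by rewrite -[leLHS]expR0 ler_expR.
by move: (expR (a * T)) m2U => z; lra.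
Qed.

(** The part in [1 / d] does not vanish with [n] and is controlled by the choice of [d]; the
    successor in the count contributes the part that decays like [1 / m]. *)
Lemma term_few (m L d : nat) c T v : (0 < d)%N -> (1 < m)%N ->
  expR (c * T) <= m%:R ->
  2 * L%:R ^+ 2 * expR (- (c * T)) <= v ->
  L%:R * ((4 * m %/ d).+1%:R * (L%:R / m.-1%:R)) <= L%:R ^+ 2 * 8 / d%:R + v.
Proof.
move=> d0 m1 mL le; have mP : 0 < m%:R :> R by rewrite ltr0n ltnW.
have dP : 0 < d%:R :> R by rewrite ltr0n.
have m1P : 0 < m.-1%:R :> R by rewrite ltr0n; lia.
have div1 : (4 * m %/ d)%:R <= 4 * m%:R / d%:R :> R.
  by rewrite ler_pdivlMr // -!natrM ler_nat leq_trunc_div.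
have inv2 : m.-1%:R^-1 <= 2 / m%:R :> R.
  by rewrite ler_pdivlMr // mulrC ler_pdivrMr // -natrM ler_nat; lia.
apply: (@le_trans _ _ (L%:R * ((4 * m%:R / d%:R + 1) * (L%:R * (2 / m%:R))))).
  rewrite ler_wpM2l // ler_pM // ?mulr_ge0 ?invr_ge0 //; first by rewrite -natr1 lerD2r.
  by rewrite ler_wpM2l.
rewrite [leLHS](_ : _ = L%:R ^+ 2 * 8 / d%:R + 2 * L%:R ^+ 2 * m%:R^-1); last first.
  by field; rewrite !gt_eqF.
rewrite lerD2l; apply: le_trans le; rewrite ler_wpM2l ?mulr_ge0 ?sqr_ge0 //.
by rewrite expRN lef_pV2 ?posrE ?expR_gt0.
Qed.

Lemma term_deviation (m1 L d B k : nat) K a x y T v : (0 < d)%N -> (0 < m1)%N ->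
  0 <= K -> 0 <= T -> expR (a * T) <= m1%:R ->
  B%:R <= K * (2 + T) ^+ k * expR (x * T) -> a - y = x ->
  L%:R * d%:R ^+ 2 / 4 * (4 * K) * (2 + T) ^+ k * expR (- (y * T)) <= v ->
  L%:R * (4 * B%:R / m1%:R / (2 / d%:R) ^+ 2) <= v.
Proof.
move=> d0 m0 K0 T0 m1L BU xE; apply: le_trans.
have dP : 0 < d%:R :> R by rewrite ltr0n.
have mP : 0 < m1%:R :> R by rewrite ltr0n.
have pow : 0 <= (2 + T) ^+ k by rewrite exprn_ge0 // addr_ge0.
have tauU : 4 * B%:R / m1%:R <= 4 * (K * (2 + T) ^+ k * expR (- (y * T))).
  rewrite -mulrA ler_wpM2l // ler_pdivrMr //; apply: le_trans BU _.
  rewrite -xE (_ : (a - y) * T = - (y * T) + a * T); last by ring.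
  by rewrite expRD mulrA ler_wpM2l // !mulr_ge0 ?expR_ge0.
rewrite [leLHS](_ : _ = L%:R * d%:R ^+ 2 / 4 * (4 * B%:R / m1%:R)); last by field; rewrite !gt_eqF.
apply: le_trans (ler_wpM2l _ tauU) _; first by rewrite !mulr_ge0.
by rewrite le_eqVlt; apply/orP; left; apply/eqP; ring.
Qed.

End Terms.

(** * Choice of the exponents *)

Section FailureSmall.
Context (R : realType).

Lemma up_bounds (x T : R) : 0 <= x -> 0 <= T ->
  expR (x * T) <= (up (x * T))%:R <= 2 * expR (x * T).
Proof. by move=> x0 T0; rewrite (ltW (up_gt _)) up_le // mulr_ge0. Qed.

(** With [N = n.+1], the scales are [m = N ^ c], [m1 = N ^ (alpha - eta)], [m2 = N ^ (alpha + eta)]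
    and [s2 = N ^ (alpha + eta - c / 4)] up to rounding, and [D] is about [6 * ln N]. The late
    clusters are smaller than [m1] by a factor [N ^ rate], up to powers of [ln N]. *)
Lemma failure_at n (eps alpha c eta theta1 theta2 v T : R) (k L d : nat) :
  let K := k.+1%:R * 6 ^+ k * 3 in let rate := c / 4 - 2 * eta in
  ln n.+1%:R = T -> 1 <= T ->
  [/\ 0 < alpha, 0 < c, 0 < eta & 0 <= alpha + eta - c / 4] ->
  alpha - c = 2 * theta1 -> 0 < theta1 <= 1 ->
  eta = 2 * theta2 -> theta2 <= 2^-1 -> c <= alpha - eta -> alpha + eta <= 1 ->
  2 <= k.+1%:R * theta2 ^+ 2 -> (1 < L)%N -> (0 < d)%N ->
  expR (2 - 2^-1 * ln L%:R) <= eps / 8 ->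
  L%:R ^+ 2 * 8 / d%:R <= eps / 8 ->
  v = eps / 16 ->
  2 * expR 1 * expR (- ((theta1 ^+ 2 / 2 - c) * T)) <= v ->
  2 * expR 1 * (2 + T) * expR (- (theta2 ^+ 2 / 2 * T)) <= v ->
  expR 1 * expR (- (1 * T)) <= v ->
  expR k.+1%:R * (2 + T) ^+ k * expR (- (1 * T)) <= v ->
  12 * expR (- (c / 2 * T)) <= v ->
  2 * L%:R ^+ 2 * expR (- (c * T)) <= v ->
  L%:R * d%:R ^+ 2 / 4 * (4 * K) * (2 + T) ^+ k * expR (- (rate * T)) <= v ->
  L%:R * expR (- (c * T)) <= 1 ->
  2 * expR (- ((1 - alpha - eta) * T)) <= 1 ->
  8 * expR (- ((alpha - eta - c) * T)) <= 1 ->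
  K * (2 + T) ^+ k * expR (- (rate * T)) <= 4^-1 ->
  Pr R (fun p : parents n => ord0 \notin root_set (d ^ 3) (forest alpha (tree p)))
  <= eps.
Proof.
move=> K rate lnN T1 [al0 c0 eta0 a2_0] th1E /andP[th1 th1'] th2E th2' c_al al1 k2 L1 d0
  Leps deps vE h1 h2 h3 h4 h5 h7 h8 f1 f2 f3 f4.
have T0 : 0 <= T by apply: le_trans T1.
have NE : n.+1%:R = expR T :> R by rewrite -lnN lnK // posrE ltr0n.
have b0 : 0 <= alpha - eta by apply: le_trans c_al; exact: ltW.
have a0 : 0 <= alpha + eta by rewrite addr_ge0 // ltW.
have th2 : 0 < theta2 by move: eta0; rewrite th2E pmulr_rgt0.
pose a2 := alpha + eta - c / 4.
pose m := up (c * T); pose m1 := up ((alpha - eta) * T); pose m2 := up ((alpha + eta) * T).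
pose s2 := up (a2 * T); pose D := (Num.truncn (6 * T)).+1.
have /andP[mL mU] : expR (c * T) <= m%:R <= 2 * expR (c * T) by rewrite up_bounds // ltW.
have /andP[m1L m1U] := up_bounds b0 T0; rewrite -/m1 in m1L m1U.
have /andP[m2L m2U] := up_bounds a0 T0; rewrite -/m2 in m2L m2U.
have /andP[s2L s2U] := up_bounds a2_0 T0; rewrite -/a2 -/s2 in s2L s2U.
have DL : 6 * T <= D%:R by apply/ltW/truncnS_gt.
have DU : D%:R <= 6 * (2 + T).
  have : (Num.truncn (6 * T))%:R <= 6 * T by rewrite truncn_le mulr_ge0.
  rewrite -[D%:R]natr1; move: (Num.truncn _)%:R => z; clear; lra.
have Lm : (L <= m)%N.
  rewrite -(ler_nat R); apply: le_trans mL.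
  by have := decay_shift c f1; rewrite subrr mul0r expR0 mulr1 mul1r.
have m2N : (m2 <= n.+1)%N.
  rewrite -(ler_nat R) NE; apply: le_trans m2U _.
  have := decay_shift 1 f2; rewrite !mul1r.
  by rewrite (_ : 1 - (1 - alpha - eta) = alpha + eta) //; clear; ring.
have m1N : (m1 <= n.+1)%N.
  apply: leq_trans m2N; rewrite ltnS; apply: le_truncn; rewrite ler_expR.
  by rewrite ler_wpM2r // lerD2l; apply: le_trans (ltW eta0); rewrite oppr_le0 ltW.
have mm1 : (4 * m <= m1)%N.
  rewrite -(ler_nat R) natrM; apply: le_trans m1L.
  have := decay_shift (alpha - eta) f3; rewrite mul1r subKr; apply: le_trans.
  by move: (expR (c * T)) mU => z; clear; lra.
have m_gt1 : (1 < m)%N by apply: leq_trans Lm.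
pose B := (k.+1 * D ^ k * s2.+1)%N.
have s2S : s2.+1%:R <= 3 * expR (a2 * T).
  have : 1 <= expR (a2 * T) by rewrite -[leLHS]expR0 ler_expR mulr_ge0.
  by rewrite -natr1; move: (expR (a2 * T)) s2U => z; clear; lra.
have pow : 0 <= (2 + T) ^+ k by rewrite exprn_ge0 // addr_ge0.
have K0 : 0 <= K by rewrite !mulr_ge0 ?exprn_ge0.
have BU : B%:R <= K * (2 + T) ^+ k * expR (a2 * T).
  rewrite /B !natrM natrX /K.
  rewrite [leRHS](_ : _ = k.+1%:R * (6 * (2 + T)) ^+ k * (3 * expR (a2 * T))); last first.
    by rewrite exprMn; clear; ring.
  rewrite ler_pM // ?mulr_ge0 ?exprn_ge0 // ler_wpM2l // lerXn2r ?nnegrE //.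
  by rewrite mulr_ge0 // addr_ge0.
have a2E : alpha - eta - rate = a2 by rewrite /rate /a2; clear; ring.
have BU4 : B%:R <= 4^-1 * expR ((alpha - eta) * T).
  by apply: le_trans BU _; have := decay_shift (alpha - eta) f4; rewrite a2E.
have Bm1 : (2 * B < m1)%N.
  rewrite -(ltr_nat R) natrM; apply: lt_le_trans m1L.
  have := expR_gt0 ((alpha - eta) * T); move: (expR _) BU4 => z; clear; lra.
have m1P : 0 < m1%:R :> R by rewrite ltr0n.
(* The least value compatible with [Btau], which then holds with equality. *)
pose tau : R := 4 * B%:R / m1%:R.
have tau0 : 0 <= tau by rewrite divr_ge0 // mulr_ge0.
have Btau : B%:R <= tau * (m1%:R / 4).
  by rewrite /tau le_eqVlt; apply/orP; left; apply/eqP; field; rewrite gt_eqF.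
apply: le_trans (@failure_bound R n alpha _ tau theta1 theta2 theta2 m m1 m2 L k D s2 d
  erefl (ltW th1) (ltW th2) (ltW th2) tau0 _ m_gt1 m1N _ _ _ d0 Bm1 mm1 Btau) _ => //.
  by rewrite Lm andbT ltnW.
have E16 : v + v + v + v + v + eps / 8 + (eps / 8 + v) + v <= eps.
  by have := lt_le_trans (expR_gt0 _) Leps; rewrite vE; clear; lra.
apply: le_trans E16.
rewrite -lnN in T0 T1 mL mU m1L m1U m2L m2U s2L s2U DL BU h1 h2 h3 h4 h5 h7 h8
  *.
have al0' := ltW al0.
do 7?[apply: lerD].
- by apply: (@term_low _ _ _ c).
- apply: term_lost => //; first by rewrite -th2E.
  by apply: le_trans th2' _; rewrite invf_le1 // ler1n.
- exact: term_indeg.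
- by apply: term_chain; rewrite // -th2E.
- by apply: (@term_descendants _ _ _ _ (alpha + eta) c a2 (ln n.+1%:R)) => //; rewrite mulr_ge0.
- exact: Leps.
- apply: le_trans (lerD deps (lexx v)).
  by apply: (@term_few _ _ _ _ c (ln n.+1%:R)).
- by apply: (@term_deviation _ _ _ _ _ k K (alpha - eta) a2 rate (ln n.+1%:R)).
Qed.

Lemma failure_small (eps alpha : R) (L d : nat) : 0 < eps -> 0 < alpha < 1 ->
  (1 < L)%N -> (0 < d)%N ->
  expR (2 - 2^-1 * ln L%:R) <= eps / 8 ->
  L%:R ^+ 2 * 8 / d%:R <= eps / 8 ->
  for_large (fun T : R => forall n, ln n.+1%:R = T ->
    Pr R (fun p : parents n => ord0 \notin root_set (d ^ 3) (forest alpha (tree p)))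
    <= eps).
Proof.
move=> eps0 /andP[al0 al1] L1 d0 Leps deps.
(* Since [theta1 >= alpha / 4], the gain [theta1 ^ 2 / 2 >= alpha ^ 2 / 32] exceeds [c], which pays
   for the union over the first [m] vertices. *)
pose c := alpha ^+ 2 / 64.
have c0 : 0 < c by rewrite divr_gt0 // exprn_gt0.
have c_al : c <= alpha / 64 by rewrite ler_pM2r // expr2 ler_piMl // ltW.
(* The first bound gives [rate >= c / 8], the second keeps [alpha + eta] below 1. *)
pose eta := Num.min (c / 16) ((1 - alpha) / 2).
have eta0 : 0 < eta by rewrite lt_min; apply/andP; split; lra.
have eta_c : eta <= c / 16 by rewrite ge_min lexx.
have eta_al : eta <= (1 - alpha) / 2 by rewrite ge_min lexx orbT.
pose theta1 := (alpha - c) / 2; pose theta2 := eta / 2.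
have th1E : alpha - c = 2 * theta1 by rewrite /theta1; field.
have th2E : eta = 2 * theta2 by rewrite /theta2; field.
have th1 : alpha / 4 <= theta1 <= 1 by rewrite /theta1; apply/andP; split; lra.
have rate1 : 0 < theta1 ^+ 2 / 2 - c.
  have : (alpha / 4) ^+ 2 <= theta1 ^+ 2.
    by case/andP: th1 => le _; rewrite ler_pXn2r ?nnegrE //; lra.
  have : 0 < alpha ^+ 2 by rewrite exprn_gt0.
  by rewrite /c expr_div_n (_ : 4 ^+ 2 = 16); [lra | rewrite -natrX].
have th2 : 0 < theta2 by rewrite divr_gt0.
clearbody theta1 theta2 eta c.
have rate2 : 0 < theta2 ^+ 2 / 2 by rewrite divr_gt0 // exprn_gt0.
pose k := Num.truncn (2 / theta2 ^+ 2).
have k2 : 2 <= k.+1%:R * theta2 ^+ 2.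
  by rewrite -ler_pdivrMr ?exprn_gt0 //; apply/ltW/truncnS_gt.
pose rate := c / 4 - 2 * eta.
have rate0 : 0 < rate by rewrite /rate; lra.
pose K : R := k.+1%:R * 6 ^+ k * 3.
have e16 : 0 < eps / 16 by rewrite divr_gt0.
have q4 : 0 < 4^-1 :> R by rewrite invr_gt0.
have rate5 : 0 < c / 2 by rewrite divr_gt0.
have rate_f2 : 0 < 1 - alpha - eta by lra.
have rate_f3 : 0 < alpha - eta - c by lra.
have := for_large_and (for_large_ge 1)
 (for_large_and (for_large_decay (2 * expR 1) 0 rate1 e16)
 (for_large_and (for_large_decay (2 * expR 1) 1 rate2 e16)
 (for_large_and (for_large_decay (expR 1) 0 ltr01 e16)
 (for_large_and (for_large_decay (expR k.+1%:R) k ltr01 e16)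
 (for_large_and (for_large_decay 12 0 rate5 e16)
 (for_large_and (for_large_decay (2 * L%:R ^+ 2) 0 c0 e16)
 (for_large_and (for_large_decay (L%:R * d%:R ^+ 2 / 4 * (4 * K)) k rate0 e16)
 (for_large_and (for_large_decay L%:R 0 c0 ltr01)
 (for_large_and (for_large_decay 2 0 rate_f2 ltr01)
 (for_large_and (for_large_decay 8 0 rate_f3 ltr01)
                (for_large_decay K k rate0 q4))))))))))).
case=> T0 large; exists T0 => T /large{large}.
case=> T1 [h1 [h2 [h3 [h4 [h5 [h7 [h8 [f1 [f2 [f3 f4]]]]]]]]]] n lnN.
rewrite expr0 mulr1 in h1; rewrite expr1 in h2; rewrite expr0 mulr1 in h3.
rewrite expr0 mulr1 in h5; rewrite expr0 mulr1 in h7; rewrite expr0 mulr1 in f1.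
rewrite expr0 mulr1 in f2; rewrite expr0 mulr1 in f3.
have th1' : 0 < theta1 <= 1.
  by case/andP: th1 => le ->; rewrite andbT; apply: lt_le_trans le; rewrite divr_gt0.
have a2 : 0 <= alpha + eta - c / 4 by move: al0 eta0 c_al; clear; lra.
have th2' : theta2 <= 2^-1 by move: th2E eta_al al0; clear; lra.
have c_al' : c <= alpha - eta by move: rate_f3; clear; lra.
have al_1 : alpha + eta <= 1 by move: rate_f2; clear; lra.
by apply: (@failure_at n eps alpha c eta theta1 theta2 (eps / 16) T k L d).
Qed.

End FailureSmall.

(** * Conclusion *)

Lemma limn_einf_ge (R : realType) (u : nat -> \bar R) (a : \bar R) n0 :
  (forall n, (n0 <= n)%N -> (a <= u n)%E) -> (a <= limn_einf u)%E.
Proof.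
move=> au; rewrite limn_einf_lim; apply: lime_ge; first exact: is_cvg_einfs.
exists n0 => // n /= n0n; apply: le_ereal_inf_tmp => _ [k /= nk <-].
by apply: au; exact: leq_trans nk.
Qed.

Lemma prob_root_set (R : realType) n M (alpha : R) :
  prob R (fun w : graph n.+1 * 'S_n.+1 =>
    w.2 ord0 \in root_set M (relabel w.2 (forest alpha w.1))) =
  1 - Pr R (fun p : parents n => ord0 \notin root_set M (forest alpha (tree p))).
Proof.
rewrite PrC subKr.
by apply: (@prob_tree R n (fun G => ord0 \in root_set M (forest alpha G))) => w;
  rewrite root_set_relabel.
Qed.

Theorem theorem1p4 (R : realType) (eps : R) (eps_gt0 : 0 < eps) :
  exists2 M : nat, (1 <= M)%N &
  forall alpha : R, 0 < alpha < 1 ->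
  exists2 K : forall n : nat, graph n -> {set 'I_n},
    forall (n : nat) (G : graph n), (2 <= n)%N -> (#|K n G| <= M)%N &
    ((1 - eps)%:E <=
       limn_einf (fun n : nat =>
         (prob R (fun w : graph n.+1 * 'S_n.+1 =>
            w.2 ord0 \in K n.+1 (relabel w.2 (forest alpha w.1))))%:E))%E.
Proof.
(* The choice [ln L >= x] makes it unlikely that the root has fewer than three children among the
   first [L] vertices. Like [d] below, [L] depends on [eps] alone, hence so does the size bound
   [d ^ 3]. *)
pose x : R := `|2 * (2 - ln (eps / 8))|; pose L := up x.
have x0 : 0 <= x := normr_ge0 _.
have L1 : (1 < L)%N by rewrite ltnS truncn_gt0 -[leLHS]expR0 ler_expR.
have Leps : expR (2 - 2^-1 * ln L%:R) <= eps / 8.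
  rewrite -[leRHS]lnK ?posrE ?divr_gt0 // ler_expR.
  have : x <= ln L%:R by rewrite -ler_expR lnK ?posrE ?ltr0n //; exact/ltW/up_gt.
  have := ler_norm (2 * (2 - ln (eps / 8))); rewrite -/x; lra.
pose d := (Num.truncn (L%:R ^+ 2 * 64 / eps)).+1.
have deps : L%:R ^+ 2 * 8 / d%:R <= eps / 8.
  have : L%:R ^+ 2 * 64 / eps < d%:R by exact: truncnS_gt.
  rewrite ltr_pdivrMr // ler_pdivrMr ?ltr0n //; lra.
exists (d ^ 3)%N; first by rewrite expn_gt0.
move=> alpha al; exists (fun n => @root_set n (d ^ 3)) => [n G _|].
  exact: card_root_set.
have [T0 large] := failure_small eps_gt0 al L1 (ltn0Sn _) Leps deps.
(* From [n >= up T0] on, [ln n.+1 >= T0]. *)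
apply: (@limn_einf_ge _ _ _ (up T0)) => n n0.
rewrite lee_fin prob_root_set lerD2l lerN2; apply: large erefl.
rewrite -ler_expR lnK ?posrE ?ltr0n //; apply: le_trans (ltW (up_gt T0)) _.
by rewrite ler_nat ltnW.
Qed.
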